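(* There exist a computable Polish space $X$, a computable Borel probability measure $\nu$ on $X$, and an almost-full effective filtration $(\mathscr F_n)$ equipped uniformly with Kurtz disintegrations $\rho^{(n)}$, such that for every computable real $p>1$ and every $x\in\mathsf{DR}^\nu_\rho(X)$ there is an $L_p(\nu)$ Martin-Löf test $f$ for which the convergence $\mathbb E_\nu[f\mid\mathscr F_n](x)\to f(x)$ has no computable rate.
   Context: A computable Polish space is a Polish space $X$ with a distinguished dense sequence $x_0,x_1,\dots$ and a compatible complete metric $d$ with $d(x_i,x_j)$ uniformly computable. An open set is c.e. open if it equals $\bigcup_i B(x_{n(i)},r_i)$ for computable $n(\cdot)$ and a computable sequence of positive rationals $r_i$. A function $f:X\to(-\infty,\infty]$ is lower semi-computable (lsc) if the sets $f^{-1}(q,\infty]$, $q\in\mathbb Q$, are uniformly c.e. open. A Borel probability measure $\nu$ is computable if $\nu(U)$ is left-c.e. uniformly in the c.e. open $U$. For computable $p\ge1$, an $L_p(\nu)$ Martin-Löf test is an lsc $f:X\to[0,\infty]$ with $\|f\|_p<\infty$. $\mathsf{KR}^\nu$ is the set of points in every c.e. open set of $\nu$-measure 1; $\mathsf{MLR}^\nu$ the set of $x$ with $f(x)<\infty$ for every $L_1(\nu)$ Martin-Löf test. A $\nu$-computable basis is a computable sequence of c.e. open sets such that every c.e. open set is effectively a union of its members, finite unions of members have uniformly computable $\nu$-measure, and each member is uniformly paired with an effectively closed superset of equal $\nu$-measure. An almost-full effective filtration is an increasing sequence $(\mathscr F_n)$ of $\sigma$-algebras, $\mathscr F_n$ generated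 by a sequence $\{A_{n,m}\}_m$, uniformly computable in $n,m$, of members of the algebra generated by a $\nu$-computable basis, with a uniform procedure computing from a c.e. open $U$ a sequence $A_{n_i,m_i}$ with $U\cap\mathsf{KR}^\nu=\bigcup_iA_{n_i,m_i}\cap\mathsf{KR}^\nu$. For countably generated $\mathscr F$, $[x]_{\mathscr F}$ is the set of points in exactly the same members of $\mathscr F$ as $x$. A Borel measurable $\rho:X\to\mathcal M^+(X)$ is a Kurtz disintegration of $\mathscr F$ with respect to $\nu$ if: (a) for every Borel $f$ with $\int|f|d\nu<\infty$, $x\mapsto\int f\,d\rho_x$ is a version of the conditional expectation of $f$ given $\mathscr F$; (b) for $x\in\mathsf{KR}^\nu$, $\rho_x(X)=1$ and $\rho_x([x]_{\mathscr F}\cap\mathsf{KR}^\nu)=1$; (c) $x\mapsto\rho_x(U)$ is lsc uniformly in c.e. open $U$. Equipped uniformly: each $\rho^{(n)}$ is such for $\mathscr F_n$, uniformly in $n$; $\mathbb E_\nu[f\mid\mathscr F_n](x)=\int f\,d\rho^{(n)}_x$. $\mathsf{DR}^\nu_\rho(X)$ is the set of $x\in\mathsf{MLR}^\nu$ with $\lim_n\rho^{(n)}_x(U)=\delta_x(U)$ for every c.e. open $U$. A rate of convergence for $y_n\to y$ is $m:\mathbb Q^{>0}\to\mathbb N$ with $|y_n-y|<\epsilon$ for all rational $\epsilon>0$ and $n\ge m(\epsilon)$. *)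

(* Defs.v *)
From HB Require Import structures.
From Stdlib Require Cantor.
From mathcomp Require Import all_boot all_order all_algebra.
From mathcomp Require Import all_classical all_reals all_analysis.
From mathcomp Require Import measurable_realfun.

Set Implicit Arguments.
Unset Strict Implicit.
Unset Printing Implicit Defensive.
Import Order.TTheory GRing.Theory Num.Theory.
Import numFieldNormedType.Exports.

Local Open Scope classical_set_scope.
Local Open Scope ring_scope.

Definition cpair (a b : nat) : nat := Cantor.to_nat (a, b).
Definition cfst (n : nat) : nat := (Cantor.of_nat n).1.
Definition csnd (n : nat) : nat := (Cantor.of_nat n).2.

(* Programs for the unary partial recursive functions; several arguments are
   passed through Cantor pairing. *)
Inductive code : Type :=
| CZero
| CSucc
| CFst
| CSnd
| CPair of code & code
| CComp of code & code
| CPrec of code & code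
| CMu of code.

(* [computes c x y]: the program [c] halts on input [x] with output [y].  In the
   primitive recursion case [s] is the sequence of intermediate values. *)
Fixpoint computes (c : code) : nat -> nat -> Prop :=
  match c with
  | CZero => fun x y => y = 0%N
  | CSucc => fun x y => y = x.+1
  | CFst => fun x y => y = cfst x
  | CSnd => fun x y => y = csnd x
  | CPair f g => fun x y =>
      exists a b, [/\ computes f x a, computes g x b & y = cpair a b]
  | CComp f g => fun x y => exists z, computes g x z /\ computes f z y
  | CPrec f g => fun x y => exists s : nat -> nat,
      [/\ computes f (cfst x) (s 0%N),
          forall i, (i < csnd x)%N ->
            computes g (cpair (cfst x) (cpair i (s i))) (s i.+1)
        & y = s (csnd x)]
  | CMu f => fun x y =>
      computes f (cpair x y) 0%N /\
      forall i, (i < y)%N -> exists z, computes f (cpair x i) z.+1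
  end.

Fixpoint code_num (c : code) : nat :=
  match c with
  | CZero => cpair 0 0
  | CSucc => cpair 1 0
  | CFst => cpair 2 0
  | CSnd => cpair 3 0
  | CPair f g => cpair 4 (cpair (code_num f) (code_num g))
  | CComp f g => cpair 5 (cpair (code_num f) (code_num g))
  | CPrec f g => cpair 6 (cpair (code_num f) (code_num g))
  | CMu f => cpair 7 (code_num f)
  end.

(* The standard enumeration of the partial recursive functions; numbers that
   are not the number of a program index the nowhere defined function. *)
Definition phi (e x y : nat) : Prop :=
  exists2 c, code_num c = e & computes c x y.

Definition phi_range (e : nat) : set nat := [set j | exists i, phi e i j].

Definition computable (g : nat -> nat) : Prop :=
  exists c, forall n, computes c n (g n).

Definition ce (P : nat -> Prop) : Prop :=
  exists c, forall n, P n <-> exists y, computes c n y.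

Definition seq_num (s : seq nat) : nat :=
  foldr (fun a n => (cpair a n).+1) 0%N s.

Definition rat_num (n : nat) : rat :=
  ((cfst n)%:R - (cfst (csnd n))%:R) / (csnd (csnd n)).+1%:R.

Definition posrat_num (n : nat) : rat := (cfst n).+1%:R / (csnd n).+1%:R.

Section reals.
Context {R : realType}.

Definition computable_reals (y : nat -> R) : Prop :=
  exists2 g, computable g &
    forall i k, `|ratr (rat_num (g (cpair i k))) - y i| <= 2 ^- k.

Definition computable_real (y : R) : Prop := computable_reals (fun=> y).

Definition left_ce_reals (y : nat -> \bar R) : Prop :=
  ce (fun n => ((ratr (rat_num (csnd n)) : R)%:E < y (cfst n))%E).

Definition is_rate (y : nat -> \bar R) (l : \bar R) (m : rat -> nat) : Prop :=
  forall eps : rat, 0 < eps -> forall n, (m eps <= n)%N ->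
    (`|y n - l| < (ratr eps : R)%:E)%E.

End reals.

(* Only the values of [m] at positive rationals are relevant. *)
Definition computable_rate (m : rat -> nat) : Prop :=
  exists2 g, computable g & forall k, m (posrat_num k) = g k.

HB.mixin Record isComputablePolish (R : realType) X
    & Metric R X & Complete X & Pointed X := {
  cpoint : nat -> X;
  cpoint_dense : dense (range cpoint);
  cpoint_dist : computable_reals
    (fun n => mdist (cpoint (cfst n)) (cpoint (csnd n)) : R)
}.

#[short(type="computablePolishType")]
HB.structure Definition ComputablePolish (R : realType) :=
  {X of isComputablePolish R X & Metric R X & Complete X & Pointed X}.

Notation borel X := (g_sigma_algebraType (@open X)).

Section computable_polish.
Context {R : realType} {X : computablePolishType R}.

Definition cball (j : nat) : set X :=
  ball (cpoint (cfst j)) (ratr (posrat_num (csnd j)) : R).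

(* The c.e. open set with index [e].  The enumeration [phi e] of balls may be
   partial, which is what makes the empty set c.e. open. *)
Definition ceopen (e : nat) : set X := \bigcup_(j in phi_range e) cball j.

Definition uniformly_lsc (f : nat -> X -> \bar R) : Prop :=
  (forall k x, (-oo < f k x)%E) /\
  exists2 g, computable g & forall k q,
    [set x | ((ratr (rat_num q) : R)%:E < f k x)%E] = ceopen (g (cpair k q)).

Definition lsc (f : X -> \bar R) : Prop := uniformly_lsc (fun=> f).

Definition computable_measure (nu : probability (borel X) R) : Prop :=
  left_ce_reals (fun e => nu (ceopen e)).

Definition ml_test (nu : probability (borel X) R) (p : R) (f : X -> \bar R) :
    Prop :=
  [/\ lsc f, forall x, (0 <= f x)%E & (Lnorm nu p%:E f < +oo)%E].

Definition KR (nu : probability (borel X) R) : set X :=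
  [set x | forall e, nu (ceopen e) = 1%E -> ceopen e x].

Definition MLR (nu : probability (borel X) R) : set X :=
  [set x | forall f, ml_test nu 1 f -> (f x < +oo)%E].

Definition computable_basis (nu : probability (borel X) R) (B : nat -> set X) :
    Prop :=
  [/\ exists2 b, computable b & forall k, B k = ceopen (b k),
      exists2 h, computable h &
        forall e, ceopen e = \bigcup_(k in phi_range (h e)) B k,
      exists2 g, computable g & forall (s : seq nat) k,
        `|ratr (rat_num (g (cpair (seq_num s) k)))
          - fine (nu (\bigcup_(i in [set` s]) B i))| <= 2 ^- k
    & exists2 c, computable c & forall k,
        B k `<=` ~` ceopen (c k) /\ nu (~` ceopen (c k)) = nu (B k)].

(* Boolean combinations of the members of a sequence of sets: names for the
   members of the algebra it generates. *)
Inductive bterm : Type :=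
| BBase of nat
| BCompl of bterm
| BUnion of bterm & bterm.

Fixpoint bterm_num (t : bterm) : nat :=
  match t with
  | BBase k => cpair 0 k
  | BCompl t => cpair 1 (bterm_num t)
  | BUnion t u => cpair 2 (cpair (bterm_num t) (bterm_num u))
  end.

Fixpoint bterm_set (B : nat -> set X) (t : bterm) : set X :=
  match t with
  | BBase k => B k
  | BCompl t => ~` bterm_set B t
  | BUnion t u => bterm_set B t `|` bterm_set B u
  end.

Definition almost_full_effective_filtration (nu : probability (borel X) R)
    (F : nat -> set (set X)) : Prop :=
  (forall n, F n `<=` F n.+1) /\
  exists (B : nat -> set X) (A : nat -> nat -> set X),
  [/\ computable_basis nu B,
      exists2 a, computable a & forall n m, exists2 t,
        bterm_num t = a (cpair n m) & A n m = bterm_set B t,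
      forall n, F n = <<s range (A n) >>
    & exists2 h, computable h & forall e,
        ceopen e `&` KR nu =
        (\bigcup_(j in phi_range (h e)) A (cfst j) (csnd j)) `&` KR nu].

Definition same_atom (F : set (set X)) (x : X) : set X :=
  [set y | forall A, F A -> (A x <-> A y)].

Definition is_cond_exp (nu : probability (borel X) R) (F : set (set X))
    (f g : X -> \bar R) : Prop :=
  [/\ measurable_fun [set: g_sigma_algebraType F]
        (g : g_sigma_algebraType F -> \bar R),
      nu.-integrable [set: borel X] g
    & forall A : set (borel X), F A ->
        \int[nu]_(x in A) g x = \int[nu]_(x in A) f x]%E.

(* Borel maps from X to the finite Borel measures are the kernels with finite
   values. *)
Definition uniform_kurtz_disintegrations (nu : probability (borel X) R)
    (F : nat -> set (set X)) (rho : nat -> R.-ker borel X ~> borel X) : Prop :=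
  [/\ forall n x, fin_num_fun (rho n x),
      forall n (f : borel X -> \bar R), nu.-integrable [set: borel X] f ->
        is_cond_exp nu (F n) f (fun x => \int[rho n x]_y f y)%E,
      forall n x, KR nu x ->
        rho n x [set: X] = 1%E /\ rho n x (same_atom (F n) x `&` KR nu) = 1%E
    & uniformly_lsc (fun k x => rho (cfst k) x (ceopen (csnd k)))].

Definition DR (nu : probability (borel X) R)
    (rho : nat -> R.-ker borel X ~> borel X) : set X :=
  [set x | MLR nu x /\ forall e,
    (fun n => rho n x (ceopen e)) @ \oo -->
      (\d_(x : borel X) (ceopen e) : \bar R)].

End computable_polish.

(* Main.v *)
(* Take Cantor space with the fair coin measure, filtered by finite prefixes.
   Let [weight j] be [2 ^- e] if [j] codes [e] together with the least
   certificate that program [e] halts on its own number, and [0] otherwise; the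
   weights are computable and summable, but a computable modulus for their
   convergence to [0] would decide the halting problem.  The bounded lower
   semi-computable function [f y = \sum_j weight j * y j] satisfies
   [E [f | F_n] x = \sum_(j < n) weight j * x j + \sum_(j >= n) weight j / 2],
   so that [E [f | F_n] x] and [E [f | F_(n+1)] x] always differ by exactly
   [weight n / 2]: at every point [x], a computable rate of convergence would be
   such a modulus. *)
Require Import Defs.
From HB Require Import structures.
From Stdlib Require Cantor.
From mathcomp Require Import all_boot all_order all_algebra zify lra.
From mathcomp Require Import all_classical all_reals all_analysis.
From mathcomp Require Import measurable_realfun.

Set Implicit Arguments.
Unset Strict Implicit.
Unset Printing Implicit Defensive.
Import Order.TTheory GRing.Theory Num.Theory.
Import numFieldNormedType.Exports.

(** * Computable functions *)

(** The relation [computes] has no step counter, and its recursion clause quantifies over a function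
    on the naturals, so halting within a bound cannot be read off it. A certificate is therefore a
    number coding a finite list of assertions, each of which follows by one rule from others in the
    list; checking it is a bounded search. Certificates also replace stages in the enumeration of
    c.e. open sets. Since [cpair e w] is at least [w], a bound on the positions that carry a large
    weight is a bound on the certificates to be searched.

    On the side of analysis, everything effective is reduced to counting. Balls are cylinders, an
    event decided by [N] bits has measure an integer over 2^N, and on each cylinder a partial sum of
    the test is an integer over a power of two. Comparisons with rationals become inequalities
    between natural numbers, and strict lower bounds are witnessed at a finite stage. *)

Lemma cfst_cpair a b : cfst (cpair a b) = a.
Proof. by rewrite /cfst /cpair Cantor.cancel_of_to. Qed.

Lemma csnd_cpair a b : csnd (cpair a b) = b.
Proof. by rewrite /csnd /cpair Cantor.cancel_of_to. Qed.

Definition cpairE := (cfst_cpair, csnd_cpair).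

Lemma cpair_eta n : cpair (cfst n) (csnd n) = n.
Proof.
by rewrite /cpair /cfst /csnd -surjective_pairing Cantor.cancel_to_of.
Qed.

Lemma cpair_ge a b : a + b <= cpair a b.
Proof. by rewrite addnC; apply/ssrnat.leP;
  exact: Cantor.to_nat_non_decreasing. Qed.

Lemma cpair_inj a b a' b' : cpair a b = cpair a' b' -> a = a' /\ b = b'.
Proof.
by move=> E; have := (congr1 cfst E, congr1 csnd E); rewrite !cpairE => -[].
Qed.

Lemma computable_ext f g : f =1 g -> computable f -> computable g.
Proof. by move=> fg [c cf]; exists c => n; rewrite -fg. Qed.

Lemma computable_comp f g :
  computable f -> computable g -> computable (fun n => f (g n)).
Proof. by move=> [c cf] [d dg]; exists (CComp c d) => n; exists (g n). Qed.

Lemma computable_fst f : computable f -> computable (fun n => cfst (f n)).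
Proof. by apply: computable_comp; exists CFst. Qed.

Lemma computable_snd f : computable f -> computable (fun n => csnd (f n)).
Proof. by apply: computable_comp; exists CSnd. Qed.

Lemma computable_S f : computable f -> computable (fun n => (f n).+1).
Proof. by apply: computable_comp; exists CSucc. Qed.

Lemma computable_pair f g : computable f -> computable g ->
  computable (fun n => cpair (f n) (g n)).
Proof.
by move=> [c cf] [d dg]; exists (CPair c d) => n; exists (f n), (g n).
Qed.

Lemma computable_id : computable (fun n => n).
Proof.
exists (CPair CFst CSnd) => n /=.
by exists (cfst n), (csnd n); rewrite cpair_eta.
Qed.

Lemma computable_cst k : computable (fun=> k).
Proof.
by elim: k => [|k]; [exists CZero | exact: computable_S].
Qed.

(** Adapts [CPrec], whose step program receives one nested pair, to a recursion with parameter [n],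
    counter and previous value as separate arguments. Arithmetic, bounded sums and bounded
    quantifiers below all come from it. *)
Lemma computable_rec b G k : computable b ->
  computable (fun z => G (cfst z) (cfst (csnd z)) (csnd (csnd z))) ->
  computable k ->
  computable (fun n => nat_rect (fun=> nat) (b n) (G n) (k n)).
Proof.
move=> [cb hb] [cg hg] hk.
have hr : computable (fun z =>
    nat_rect (fun=> nat) (b (cfst z)) (G (cfst z)) (csnd z)).
  exists (CPrec cb cg) => z.
  exists (nat_rect (fun=> nat) (b (cfst z)) (G (cfst z))); split => // i _.
  have := hg (cpair (cfst z)
    (cpair i (nat_rect (fun=> nat) (b (cfst z)) (G (cfst z)) i))).
  by rewrite !cpairE.
apply: computable_ext (computable_comp hr (computable_pair computable_id hk)).
by move=> n; rewrite !cpairE.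
Qed.

Create HintDb comp discriminated.
#[local] Hint Resolve computable_fst computable_snd computable_S
  computable_pair computable_id computable_cst : comp.

Ltac comptac := auto 60 with comp nocore.

Lemma computable_pred f : computable f -> computable (fun n => (f n).-1).
Proof.
move=> hf; apply: computable_ext
  (@computable_rec (fun=> 0) (fun _ i _ => i) f _ _ hf); [|comptac|comptac].
by move=> n; case: (f n).
Qed.
#[local] Hint Resolve computable_pred : comp.

Lemma computable_iter h f k : computable h -> computable f -> computable k ->
  computable (fun n => iter (k n) h (f n)).
Proof.
move=> hh hf hk; apply: computable_ext
  (@computable_rec f (fun _ _ r => h r) k hf _ hk).
  by move=> n; elim: (k n) => //= m ->.
by apply: computable_comp hh _; comptac.
Qed.

Lemma computable_add f g : computable f -> computable g ->
  computable (fun n => f n + g n).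
Proof.
move=> hf hg; apply: computable_ext
  (@computable_rec f (fun _ _ r => r.+1) g hf _ hg); last by comptac.
by move=> n; elim: (g n) => [|m]; rewrite ?addn0 //= addnS => ->.
Qed.

Lemma computable_sub f g : computable f -> computable g ->
  computable (fun n => f n - g n).
Proof.
move=> hf hg; apply: computable_ext
  (@computable_rec f (fun _ _ r => r.-1) g hf _ hg); last by comptac.
by move=> n; elim: (g n) => [|m]; rewrite ?subn0 //= subnS => ->.
Qed.
#[local] Hint Resolve computable_add computable_sub : comp.

Lemma computable_mul f g : computable f -> computable g ->
  computable (fun n => f n * g n).
Proof.
move=> hf hg; apply: computable_ext
  (@computable_rec (fun=> 0) (fun n _ r => r + f n) g _ _ hg); [|comptac|].
  by move=> n; elim: (g n) => [|m]; rewrite ?muln0 //= mulnS addnC => ->.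
by apply: computable_add; [comptac | apply: computable_comp; comptac].
Qed.
#[local] Hint Resolve computable_mul : comp.

Lemma computable_exp b f : computable f -> computable (fun n => b ^ f n).
Proof.
move=> hf; apply: computable_ext
  (@computable_rec (fun=> 1) (fun n _ r => r * b) f _ _ hf); [|comptac|comptac].
by move=> n; elim: (f n) => [|m] //= ->; rewrite expnSr.
Qed.

Definition decidable_pred (P : nat -> bool) : Prop :=
  computable (fun n => nat_of_bool (P n)).

Lemma decidable_neq0 f : computable f -> decidable_pred (fun n => 0 < f n).
Proof.
move=> hf; apply: computable_ext
  (@computable_rec (fun=> 0) (fun _ _ _ => 1) f _ _ hf); [|comptac|comptac].
by move=> n; case: (f n).
Qed.

Lemma decidable_leq f g : computable f -> computable g ->
  decidable_pred (fun n => f n <= g n).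
Proof.
move=> hf hg; have h : computable (fun n => 1 - nat_of_bool (0 < f n - g n)).
  by have := decidable_neq0 (computable_sub hf hg); rewrite /decidable_pred;
    comptac.
by apply: computable_ext h => n; rewrite subn_gt0; case: leqP.
Qed.

Lemma decidable_ext P Q : P =1 Q -> decidable_pred P -> decidable_pred Q.
Proof. by move=> PQ; apply: computable_ext => n; rewrite PQ. Qed.

Lemma decidable_and P Q : decidable_pred P -> decidable_pred Q ->
  decidable_pred (fun n => P n && Q n).
Proof.
move=> hP hQ; apply: computable_ext (computable_mul hP hQ) => n.
by rewrite mulnb.
Qed.

Lemma decidable_not P : decidable_pred P -> decidable_pred (fun n => ~~ P n).
Proof.
move=> hP; apply: computable_ext (computable_sub (computable_cst 1) hP) => n.
by case: (P n).
Qed.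

Lemma decidable_or P Q : decidable_pred P -> decidable_pred Q ->
  decidable_pred (fun n => P n || Q n).
Proof.
move=> hP hQ; apply: decidable_ext
  (decidable_not (decidable_and (decidable_not hP) (decidable_not hQ))) => n.
by rewrite -negb_or negbK.
Qed.

Lemma decidable_impl P Q : decidable_pred P -> decidable_pred Q ->
  decidable_pred (fun n => P n ==> Q n).
Proof.
move=> hP hQ; apply: decidable_ext (decidable_or (decidable_not hP) hQ) => n.
by rewrite implybE.
Qed.

Lemma decidable_eq f g : computable f -> computable g ->
  decidable_pred (fun n => f n == g n).
Proof.
move=> hf hg; apply: decidable_ext
  (decidable_and (decidable_leq hf hg) (decidable_leq hg hf)) => n.
by rewrite eqn_leq.
Qed.

Lemma decidable_if P Q S : decidable_pred P -> decidable_pred Q ->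
  decidable_pred S -> decidable_pred (fun n => if P n then Q n else S n).
Proof.
move=> hP hQ hS; apply: decidable_ext (decidable_or (decidable_and hP hQ)
  (decidable_and (decidable_not hP) hS)) => n.
by case: (P n); rewrite ?orbF.
Qed.

Lemma computable_if P f g : decidable_pred P -> computable f -> computable g ->
  computable (fun n => if P n then f n else g n).
Proof.
move=> hP hf hg; apply: computable_ext (computable_add (computable_mul hP hf)
  (computable_mul (decidable_not hP) hg)) => n.
by case: (P n); rewrite ?mul1n ?mul0n ?addn0.
Qed.

Lemma computable_bool P : decidable_pred P ->
  computable (fun n => nat_of_bool (P n)).
Proof. by []. Qed.

Lemma computable_sum k F : computable k ->
  computable (fun z => F (cfst z) (csnd z)) ->
  computable (fun n => \sum_(0 <= i < k n) F n i).
Proof.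
move=> hk hF; apply: computable_ext
  (@computable_rec (fun=> 0) (fun n i r => r + F n i) k _ _ hk); [|comptac|].
  move=> n; elim: (k n) => [|m] /=; first by rewrite big_geq.
  by rewrite big_nat_recr //= => ->.
apply: computable_add; first comptac.
have := computable_comp hF (computable_pair (computable_fst computable_id)
  (computable_fst (computable_snd computable_id))).
by apply: computable_ext => n; rewrite !cpairE.
Qed.

Lemma decidable_comp P f :
  decidable_pred P -> computable f -> decidable_pred (fun n => P (f n)).
Proof. exact: computable_comp. Qed.

Lemma decidable_has k P : computable k ->
  decidable_pred (fun z => P (cfst z) (csnd z)) ->
  decidable_pred (fun n => has (P n) (iota 0 (k n))).
Proof.
move=> hk hP.
have := decidable_neq0 (computable_sum (F := fun n i => P n i) hk hP).
apply: decidable_ext => n; rewrite has_count -sum1_count [in RHS]big_mkcond.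
by rewrite /index_iota subn0; congr (_ < _); apply: eq_bigr => i _;
  case: (P n i).
Qed.

Lemma decidable_all k P : computable k ->
  decidable_pred (fun z => P (cfst z) (csnd z)) ->
  decidable_pred (fun n => all (P n) (iota 0 (k n))).
Proof.
move=> hk hP; have h : decidable_pred (fun z => ~~ P (cfst z) (csnd z)).
  exact: decidable_not.
have := decidable_not (decidable_has (P := fun n i => ~~ P n i) hk h).
apply: decidable_ext => n; rewrite -all_predC.
by apply: eq_all => i /=; rewrite negbK.
Qed.

#[local] Hint Resolve computable_exp decidable_leq decidable_eq decidable_and
  decidable_or decidable_not decidable_impl decidable_if computable_if
  computable_bool computable_sum decidable_has decidable_all : comp.

(** The quotient of [a] by [d] is the number of [i < a] with [i.+1 * d <= a]; the conjunct
    [1 <= csnd z] makes the count 0 for a zero divisor, as in the library convention. *)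
Lemma computable_div f g : computable f -> computable g ->
  computable (fun n => f n %/ g n).
Proof.
move=> hf hg.
have H : computable (fun z => cfst z %/ csnd z).
  have h : computable (fun z => \sum_(0 <= i < cfst z)
      nat_of_bool ((1 <= csnd z) && (i.+1 * csnd z <= cfst z))) by comptac.
  apply: computable_ext h => z; set a := cfst z; set d := csnd z.
  case: (posnP d) => [->|d0]; first by rewrite divn0 big1.
  transitivity (\sum_(0 <= i < a) nat_of_bool (i < a %/ d)).
    by apply: eq_bigr => i _; rewrite /= leq_divRL.
  transitivity (minn a (a %/ d)).
    elim: a (a %/ d) => [|m IH] q; first by rewrite big_geq // min0n.
    by rewrite big_nat_recr //= IH; case: (ltnP m q); lia.
  by apply/minn_idPr; exact: leq_div.
apply: computable_ext (computable_comp H (computable_pair hf hg)) => n.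
by rewrite !cpairE.
Qed.
#[local] Hint Resolve computable_div : comp.

Lemma computable_mod f g : computable f -> computable g ->
  computable (fun n => f n %% g n).
Proof.
move=> hf hg; have h : computable (fun n => f n - f n %/ g n * g n) by comptac.
by apply: computable_ext h => n; rewrite {1}(divn_eq (f n) (g n)) addKn.
Qed.
#[local] Hint Resolve computable_mod : comp.

Lemma decidable_odd f : computable f -> decidable_pred (fun n => odd (f n)).
Proof.
move=> hf; have h : decidable_pred (fun n => f n %% 2 == 1) by comptac.
by apply: decidable_ext h => n; rewrite modn2 eqb1.
Qed.
#[local] Hint Resolve decidable_odd : comp.

(* Lists are coded by [seq_num]: [ctail] is the tail and [smem] membership. *)
Definition ctail n := csnd n.-1.

Definition smem a n :=
  has (fun i => (0 < iter i ctail n) && (cfst (iter i ctail n).-1 == a))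
    (iota 0 n).

Lemma size_seq_num s : size s <= seq_num s.
Proof.
elim: s => //= a s IH; rewrite ltnS (leq_trans IH) //.
by rewrite (leq_trans _ (cpair_ge _ _)) // leq_addl.
Qed.

Lemma smem_seq_num a s : smem a (seq_num s) = (a \in s).
Proof.
have E i : iter i ctail (seq_num s) = seq_num (drop i s).
  elim: i => [|i IH]; first by rewrite drop0.
  rewrite iterS IH -add1n -drop_drop; case: (drop i s) => [|b t].
    by rewrite /ctail /= /csnd.
  by rewrite /ctail /= csnd_cpair drop0.
apply/hasP/idP => [[i _]|/nthP - /(_ 0) [i ilt <-]].
  rewrite E; case D : (drop i s) => [|b t] //=; rewrite cfst_cpair => /eqP <-.
  by apply: (@mem_drop i); rewrite D mem_head.
exists i; first by rewrite mem_iota /= add0n (leq_trans ilt) ?size_seq_num.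
by rewrite E (drop_nth 0 ilt) /= cfst_cpair eqxx.
Qed.

Lemma computable_ctail : computable ctail.
Proof. by rewrite /ctail; comptac. Qed.

Lemma iter_ctail_leq i n : iter i ctail n <= n.
Proof.
elim: i => //= i; apply: leq_trans; rewrite /ctail.
rewrite -[leqRHS](cpair_eta); set m := iter i ctail n.
rewrite cpair_eta; case: m => // m /=; rewrite ltnW // ltnS -{2}(cpair_eta m).
by rewrite (leq_trans _ (cpair_ge _ _)) // leq_addl.
Qed.

(** The code of a list bounds its members, so a quantifier over the members of [w] is a bounded
    quantifier. This is the origin of every range [iota 0 w] below. *)
Lemma smem_lt a n : smem a n -> a < n.
Proof.
case/hasP => i _ /andP[]; have := iter_ctail_leq i n.
case: (iter i ctail n) => // m mn _ /= /eqP <-; apply: leq_trans mn.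
by rewrite ltnS -{2}(cpair_eta m) (leq_trans _ (cpair_ge _ _)) // leq_addr.
Qed.

Lemma decidable_smem f g : computable f -> computable g ->
  decidable_pred (fun n => smem (f n) (g n)).
Proof.
move=> hf hg.
have H : decidable_pred (fun z => smem (cfst z) (csnd z)).
  apply: decidable_has; first comptac.
  have h : computable (fun z => iter (csnd z) ctail (csnd (cfst z))).
    by apply: computable_iter; [exact: computable_ctail|comptac|comptac].
  by comptac.
apply: decidable_ext (decidable_comp H (computable_pair hf hg)) => n.
by rewrite !cpairE.
Qed.
#[local] Hint Resolve decidable_smem : comp.

(** * A universal predicate *)

Definition fact e x y := cpair 0 (cpair e (cpair x y)).

(** Needed besides [fact] because a run may skip a subprogram: [CPrec f g] with counter 0 never
    evaluates [g], so a derivation about [cpair 6 (cpair f g)] does not show that [g] is the number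
    of a program. *)
Definition codeq e := cpair 1 e.

(* [justified M m]: the assertion [m] ("[e] is the number of a program" or
   "program [e] maps [x] to [y]") follows in one step from assertions in [M]. *)
Inductive justified (M : nat -> Prop) : nat -> Prop :=
| QBase i : i < 4 -> justified M (codeq (cpair i 0))
| QBin i f g : 4 <= i < 7 -> M (codeq f) -> M (codeq g) ->
    justified M (codeq (cpair i (cpair f g)))
| QMu f : M (codeq f) -> justified M (codeq (cpair 7 f))
| JZero x : justified M (fact (cpair 0 0) x 0)
| JSucc x : justified M (fact (cpair 1 0) x x.+1)
| JFst x : justified M (fact (cpair 2 0) x (cfst x))
| JSnd x : justified M (fact (cpair 3 0) x (csnd x))
| JPair f g x a b : M (fact f x a) -> M (fact g x b) ->
    justified M (fact (cpair 4 (cpair f g)) x (cpair a b))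
| JComp f g x z y : M (fact g x z) -> M (fact f z y) ->
    justified M (fact (cpair 5 (cpair f g)) x y)
| JPrec0 f g a y : M (fact f a y) ->
    justified M (fact (cpair 6 (cpair f g)) (cpair a 0) y)
| JPrecS f g a k r y : M (fact (cpair 6 (cpair f g)) (cpair a k) r) ->
    M (fact g (cpair a (cpair k r)) y) ->
    justified M (fact (cpair 6 (cpair f g)) (cpair a k.+1) y)
| JMu f x y : M (fact f (cpair x y) 0) ->
    (forall i, i < y -> exists z, M (fact f (cpair x i) z.+1)) ->
    justified M (fact (cpair 7 f) x y).

Lemma justified_mono (M N : nat -> Prop) m :
  (forall k, M k -> N k) -> justified M m -> justified N m.
Proof.
move=> MN; case; try by move=> *; econstructor; eauto.
by move=> f x y ? H; constructor; [exact: MN | move=> i /H [z /MN]; exists z].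
Qed.

Definition supported (s : seq nat) :=
  forall m, m \in s -> justified (fun k => k \in s) m.

Lemma supported_cat s t : supported s -> supported t -> supported (s ++ t).
Proof.
move=> hs ht m; rewrite mem_cat => /orP[/hs|/ht]; apply: justified_mono => k.
  by rewrite mem_cat => ->.
by rewrite mem_cat => ->; rewrite orbT.
Qed.

Lemma supported_cons m s :
  supported s -> justified (fun k => k \in s) m -> supported (m :: s).
Proof.
move=> hs hm k; rewrite inE => /predU1P[->|/hs]; [move: hm|];
  by apply: justified_mono => j; rewrite inE => ->; rewrite orbT.
Qed.

Lemma codeq_supported c : exists2 s, supported s & codeq (code_num c) \in s.
Proof.
have base i : i < 4 -> exists2 s, supported s & codeq (cpair i 0) \in s.
  move=> i4; exists [:: codeq (cpair i 0)]; last exact: mem_head.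
  by apply: supported_cons => //; constructor.
have bin i f g : 4 <= i < 7 ->
    (exists2 s, supported s & codeq f \in s) ->
    (exists2 s, supported s & codeq g \in s) ->
    exists2 s, supported s & codeq (cpair i (cpair f g)) \in s.
  move=> hi [s hs fs] [t ht gt]; exists (codeq (cpair i (cpair f g)) :: s ++ t).
    apply: supported_cons; first exact: supported_cat.
    by constructor => //; rewrite mem_cat ?fs ?gt ?orbT.
  exact: mem_head.
elim: c => [||||f hf g hg|f hf g hg|f hf g hg|f [s hs fs]]; rewrite /code_num;
  try by [exact: base|exact: bin].
exists (codeq (cpair 7 (code_num f)) :: s); last exact: mem_head.
by apply: supported_cons => //; constructor.
Qed.

Lemma computes_supported c x y : computes c x y ->
  exists2 s, supported s & fact (code_num c) x y \in s.
Proof.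
have add m s : supported s -> justified (fun k => k \in s) m ->
    exists2 s, supported s & m \in s.
  by move=> hs hm; exists (m :: s); [exact: supported_cons|exact: mem_head].
have nil : supported [::] by [].
elim: c x y => [||||f IHf g IHg|f IHf g IHg|f IHf g IHg|f IHf] x y /=.
- by move=> ->; apply: (add _ [::]) => //; constructor.
- by move=> ->; apply: (add _ [::]) => //; constructor.
- by move=> ->; apply: (add _ [::]) => //; constructor.
- by move=> ->; apply: (add _ [::]) => //; constructor.
- move=> [a [b [/IHf [s hs sa] /IHg [t ht tb] ->]]].
  apply: (add _ (s ++ t)); first exact: supported_cat.
  by constructor; rewrite mem_cat ?sa ?tb ?orbT.
- move=> [z [/IHg [t ht tb] /IHf [s hs sa]]].
  apply: (add _ (s ++ t)); first exact: supported_cat.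
  by apply: (@JComp _ _ _ _ z); rewrite mem_cat ?sa ?tb ?orbT.
- move=> [r [h0 hS ->]].
  suff H k : k <= csnd x -> exists2 s, supported s &
      fact (code_num (CPrec f g)) (cpair (cfst x) k) (r k) \in s.
    by have := H _ (leqnn _); rewrite cpair_eta.
  elim: k => [_|k IH kx].
    have [s hs sa] := IHf _ _ h0.
    by apply: (add _ s) => //; constructor.
  have [s hs sa] := IH (ltnW kx); have [t ht tb] := IHg _ _ (hS _ kx).
  apply: (add _ (s ++ t)); first exact: supported_cat.
  by apply: (@JPrecS _ _ _ _ _ (r k)); rewrite mem_cat ?sa ?tb ?orbT.
- move=> [/IHf [s hs sa] H].
  (* Each argument below the minimum has a supporting list of its own; they are merged by induction
     on [y]. *)
  suff [t ht tb] : exists2 t, supported t &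
      forall i, i < y -> exists z, fact (code_num f) (cpair x i) z.+1 \in t.
    apply: (add _ (s ++ t)); first exact: supported_cat.
    constructor; first by rewrite mem_cat sa.
    by move=> i /tb [z hz]; exists z; rewrite mem_cat hz orbT.
  elim: y {sa} H => [|y IH] H; first by exists [::].
  have [t ht tb] := IH (fun i iy => H i (ltnW iy)).
  have [z /IHf [u hu uz]] := H y (ltnSn y).
  exists (t ++ u); first exact: supported_cat.
  move=> i; rewrite ltnS leq_eqVlt => /predU1P[->|/tb [z' hz']].
    by exists z; rewrite mem_cat uz orbT.
  by exists z'; rewrite mem_cat hz'.
Qed.

Definition closed_under_just (M : nat -> Prop) :=
  forall m, M m -> justified M m.

Lemma fact_inj e x y e' x' y' : fact e x y = fact e' x' y' ->
  [/\ e = e', x = x' & y = y'].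
Proof. by move=> /cpair_inj[_] /cpair_inj[-> /cpair_inj[-> ->]]. Qed.

Lemma codeq_sound M e : closed_under_just M -> M (codeq e) ->
  exists c, code_num c = e.
Proof.
move=> hM; elim/ltn_ind: e => e IH /hM.
move E: (codeq e) => m J; case: J E => //.
all: try by move=> *; match goal with H : codeq _ = fact _ _ _ |- _ =>
  by have [] := cpair_inj H end.
- move=> i i4 /cpair_inj[_ ->].
  case: i i4 => [|[|[|[|//]]]] _; [exists CZero|exists CSucc|exists CFst|exists
    CSnd];
  done.
- move=> i f g /andP[i4 i7] Mf Mg /cpair_inj[_ eE].
  (* The positive tag [i] makes [f] and [g] strictly smaller than [e], as the strong induction
     requires. *)
  have := cpair_ge i (cpair f g); have := cpair_ge f g; rewrite -eE => h1 h2.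
  have [|c cE] := IH f _ Mf; first by lia.
  have [|d dE] := IH g _ Mg; first by lia.
  rewrite eE -cE -dE; case: i i4 i7 {h1 h2 eE} => [|[|[|[|[|[|[|//]]]]]]] // _
    _.
  + by exists (CPair c d).
  + by exists (CComp c d).
  + by exists (CPrec c d).
- move=> f Mf /cpair_inj[_ eE]; have := cpair_ge 7 f; rewrite -eE => h.
  have [|c cE] := IH f _ Mf; first by lia.
  by exists (CMu c); rewrite eE -cE.
Qed.

(** As [cpair] is a function and not a constructor, the rules cannot be told apart by plain
    inversion; the assertion is generalized and the impossible rules are discarded by injectivity of
    pairing. *)
Ltac invert_fact :=
  let E := fresh "E" in let m := fresh "m" in let J := fresh "J" in
  move E: (fact _ _ _) => m J; case: J E; intros;
  lazymatch goal with
  | E : fact _ _ _ = codeq _ |- _ => by have [] := cpair_inj E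
  | E : fact _ _ _ = fact _ _ _ |- _ =>
      have [/cpair_inj[? ?] ? ?] := fact_inj E; try discriminate
  end.

(** No order is imposed on the assertions, yet circular support is harmless: every rule appeals to
    facts about proper subprograms, or, for [JPrecS], about the same program at a smaller counter.
    Induction on [c], with an inner induction on the counter, therefore suffices. *)
Lemma fact_sound M c x y : closed_under_just M ->
  M (fact (code_num c) x y) -> computes c x y.
Proof.
move=> hM.
elim: c x y => [||||f IHf g IHg|f IHf g IHg|f IHf g IHg|f IHf] x y;
  rewrite /code_num -/code_num.
1-4: by move=> /hM; invert_fact; subst.
- move=> /hM; invert_fact; subst.
  match goal with H : cpair _ _ = cpair _ _ |- _ => case/cpair_inj:
    H => ? ? end.
  by subst; exists a, b; split; auto.
- move=> /hM; invert_fact; subst.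
  match goal with H : cpair _ _ = cpair _ _ |- _ => case/cpair_inj:
    H => ? ? end.
  by subst; exists z; split; auto.
- rewrite -(cpair_eta x) /=; move: (cfst x) => a; rewrite !cpairE.
  elim: (csnd x) y => [|k IH] y /hM; invert_fact; subst;
  match goal with H : cpair _ _ = cpair _ _, H' : cpair _ _ = cpair _ _ |- _ =>
    case/cpair_inj: H => ? ?; case/cpair_inj: H' => ? ?; subst end => //.
    by exists (fun=> y0); split; auto.
  match goal with H : k.+1 = k0.+1 |- _ => case: H => kE end; subst k0.
  match goal with H : M (fact (cpair 6 _) _ _), H' :
    M (fact _ (cpair _ (cpair _ _)) _) |- _ =>
    have [s [s0 sS rE]] := IH _ H; have gy := IHg _ _ H' end.
  exists (fun i => if i <= k then s i else y0); split => //=; last first.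
    by rewrite ltnn.
  move=> i; rewrite ltnS => ik; rewrite ik; case: ltnP => [/sS //|ki].
  have -> : i = k by apply/eqP; rewrite eqn_leq ik.
  by rewrite -rE.
- move=> /hM; invert_fact; subst.
  split; first by apply: IHf.
  by move=> i ilt; case: (e i ilt) => z /IHf; exists z.
Qed.

Definition just_code w q :=
  [|| (cfst q < 4) && (csnd q == 0),
      [&& 4 <= cfst q, cfst q < 7, smem (codeq (cfst (csnd q))) w
        & smem (codeq (csnd (csnd q))) w]
    | (cfst q == 7) && smem (codeq (csnd q)) w].

(** Boolean form of the rules that conclude a [fact]. The intermediate values [z] and [r] occur in
    listed assertions, hence lie below [w] by [fact_lt], which keeps the search bounded. *)
Definition just_fact w e x y :=
  let f := cfst (csnd e) in let g := csnd (csnd e) in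
  [|| (e == cpair 0 0) && (y == 0),
      (e == cpair 1 0) && (y == x.+1),
      (e == cpair 2 0) && (y == cfst x),
      (e == cpair 3 0) && (y == csnd x),
      [&& cfst e == 4, smem (fact f x (cfst y)) w & smem (fact g x (csnd y)) w],
      (cfst e == 5) &&
      has (fun z => smem (fact g x z) w && smem (fact f z y) w) (iota 0 w),
      [&& cfst e == 6, csnd x == 0 & smem (fact f (cfst x) y) w],
      [&& cfst e == 6, 0 < csnd x & has (fun r =>
        smem (fact e (cpair (cfst x) (csnd x).-1) r) w &&
        smem (fact g (cpair (cfst x) (cpair (csnd x).-1 r)) y) w) (iota 0 w)]
    | [&& cfst e == 7, smem (fact (csnd e) (cpair x y) 0) w &
        all (fun i => has (fun z =>
          smem (fact (csnd e) (cpair x i) z.+1) w) (iota 0 w)) (iota 0 y)]].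

Definition just w m :=
  (cfst m == 1) && just_code w (csnd m) ||
  (cfst m == 0) && just_fact w (cfst (csnd m))
    (cfst (csnd (csnd m))) (csnd (csnd (csnd m))).

Lemma decidable_just f g : computable f -> computable g ->
  decidable_pred (fun n => just (f n) (g n)).
Proof.
move=> hf hg.
have H : decidable_pred (fun z => just (cfst z) (csnd z)).
  by rewrite /just /just_code /just_fact /fact /codeq /=; comptac.
apply: decidable_ext (decidable_comp H (computable_pair hf hg)) => n.
by rewrite !cpairE.
Qed.
#[local] Hint Resolve decidable_just : comp.

Lemma has_iotaP (P : nat -> bool) k :
  reflect (exists2 i, i < k & P i) (has P (iota 0 k)).
Proof.
apply: (iffP hasP) => -[i]; rewrite ?mem_iota /= ?add0n => ik Pi;
  exists i => //.
by rewrite mem_iota add0n.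
Qed.

Lemma all_iotaP (P : nat -> bool) k :
  reflect (forall i, i < k -> P i) (all P (iota 0 k)).
Proof.
apply: (iffP allP) => H i; have := H i; rewrite mem_iota /= add0n //.
Qed.

Lemma fact_lt e x y w : smem (fact e x y) w -> [/\ e < w, x < w & y < w].
Proof.
move=> /smem_lt; rewrite /fact.
have := cpair_ge 0 (cpair e (cpair x y)); have := cpair_ge e (cpair x y).
by have := cpair_ge x y; split; lia.
Qed.

Lemma fact_eta m : cfst m = 0 ->
  m = fact (cfst (csnd m)) (cfst (csnd (csnd m))) (csnd (csnd (csnd m))).
Proof. by move=> m0; rewrite /fact !cpair_eta -m0 cpair_eta. Qed.

Lemma just_justified w m : just w m -> justified (fun k => smem k w) m.
Proof.
rewrite /just /just_code /just_fact; case/orP=> /andP[/eqP mE].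
  have -> : m = codeq (csnd m) by rewrite /codeq -mE cpair_eta.
  rewrite /codeq cpairE; set q := csnd m.
  case/or3P => [/andP[q4 /eqP q0]|/and4P[q4 q7 qf qg]|/andP[/eqP q7 qf]].
  - by rewrite -(cpair_eta q) q0; constructor.
  - by rewrite -(cpair_eta q) -(cpair_eta (csnd q)); constructor; rewrite ?q4.
  - by rewrite -(cpair_eta q) q7; constructor.
rewrite [m in justified _ m](fact_eta mE).
set e := cfst (csnd m); set x := cfst (csnd (csnd m)).
set y := csnd (csnd (csnd m)).
have eE i : cfst e == i -> e = cpair i (cpair (cfst (csnd e)) (csnd (csnd e))).
  by move=> /eqP <-; rewrite !cpair_eta.
case/orP=> [/andP[/eqP -> /eqP ->]|]; first by constructor.
case/orP=> [/andP[/eqP -> /eqP ->]|]; first by constructor.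
case/orP=> [/andP[/eqP -> /eqP ->]|]; first by constructor.
case/orP=> [/andP[/eqP -> /eqP ->]|]; first by constructor.
case/orP=> [/and3P[/eE eqe H1 H2]|].
  by rewrite eqe -(cpair_eta y); constructor.
case/orP=> [/andP[/eE eqe /has_iotaP[z _ /andP[H1 H2]]]|].
  by rewrite eqe; apply: (@JComp _ _ _ _ z).
case/orP=> [/and3P[/eE eqe /eqP x0 H1]|].
  by rewrite eqe -(cpair_eta x) x0; constructor.
case/orP=> [/and3P[/eE eqe x0 /has_iotaP[r _ /andP[H1 H2]]]|].
  rewrite eqe -(cpair_eta x) -(prednK x0); apply: (@JPrecS _ _ _ _ _ r) => //.
  by rewrite -eqe.
case/and3P=> /eqP e7 H1 /all_iotaP H2.
rewrite -(cpair_eta e) e7; constructor => // i /H2 /has_iotaP[z _ hz].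
by exists z.
Qed.

Lemma justified_just w m : justified (fun k => smem k w) m -> just w m.
Proof.
case.
- by move=> i i4; rewrite /just /just_code /codeq !cpairE i4.
- move=> i f g /andP[i4 i7] hf hg.
  by rewrite /just /just_code {1 2 3 4 5 6 8 10}/codeq !cpairE i4 i7 hf hg orbT.
- move=> f hf; rewrite /just /just_code /codeq !cpairE.
  by rewrite /codeq in hf; rewrite hf !orbT.
all: have red e x y : just_fact w e x y -> just w (fact e x y) by
  move=> H; rewrite /just /fact !cpairE H.
- by move=> x; apply: red; rewrite /just_fact !eqxx ?orbT.
- by move=> x; apply: red; rewrite /just_fact !eqxx ?orbT.
- by move=> x; apply: red; rewrite /just_fact !eqxx ?orbT.
- by move=> x; apply: red; rewrite /just_fact !eqxx ?orbT.
- move=> f g x a b hf hg; apply: red.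
  by rewrite /just_fact !cpairE hf hg !eqxx ?orbT.
- move=> f g x z y hg hf; apply: red; rewrite /just_fact !cpairE.
  have -> : has (fun z => smem (fact g x z) w && smem (fact f z y) w) (iota 0
    w).
    by apply/has_iotaP; exists z; [case: (fact_lt hf)|rewrite hf hg].
  by rewrite !eqxx ?orbT.
- move=> f g a y hf; apply: red.
  by rewrite /just_fact !cpairE hf !eqxx ?orbT.
- move=> f g a k r y hr hg; apply: red; rewrite /just_fact !cpairE /=.
  set h := has _ _; have -> : h.
    by apply/has_iotaP; exists r; [case: (fact_lt hr)|rewrite hr hg].
  by rewrite ?orbT.
- move=> f x y h0 hS; apply: red; rewrite /just_fact !cpairE h0.
  set h := all _ _; have -> : h.
    apply/all_iotaP => i /hS [z hz]; apply/has_iotaP; exists z => //.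
    by have [_ _ /ltnW] := fact_lt hz.
  by rewrite !eqxx ?orbT.
Qed.

Definition valid w := all (fun m => smem m w ==> just w m) (iota 0 w).

Lemma validP w : reflect (closed_under_just (fun m => smem m w)) (valid w).
Proof.
apply: (iffP (all_iotaP _ _)) => H m.
  by move=> mw; apply: just_justified; apply: (implyP (H m (smem_lt mw))).
by move=> _; apply/implyP => /H; exact: justified_just.
Qed.

(* The certificate [w] witnesses that [phi e x y] holds. *)
Definition run w e x y := [&& valid w, smem (codeq e) w & smem (fact e x y) w].

Lemma run_phi w e x y : run w e x y -> phi e x y.
Proof.
case/and3P => /validP vw /(codeq_sound vw) [c cE]; rewrite -cE => h.
by exists c => //; exact: (fact_sound vw h).
Qed.

Lemma supported_valid s : supported s -> valid (seq_num s).
Proof.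
move=> hs; apply/validP => m; rewrite smem_seq_num => /hs.
by apply: justified_mono => k; rewrite smem_seq_num.
Qed.

(** One certificate serves finitely many runs, because supported lists can be concatenated.
    [measure_checkP] uses this to certify a whole list of balls at once. *)
Lemma phi_run (I : seq (nat * nat)) e :
  (forall i, i \in I -> phi e i.1 i.2) ->
  exists w, forall i, i \in I -> run w e i.1 i.2.
Proof.
suff H : (forall i, i \in I -> phi e i.1 i.2) ->
    exists2 s, supported s & forall i, i \in I ->
      codeq e \in s /\ fact e i.1 i.2 \in s.
  move=> /H [s hs hI]; exists (seq_num s) => i /hI [h1 h2].
  by rewrite /run !smem_seq_num h1 h2 supported_valid.
elim: I => [|i I IH] H; first by exists [::].
have [s hs sI] := IH (fun j jI => H j (@mem_behead _ (i :: I) j jI)).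
have [c cE /computes_supported [t ht ti]] := H i (mem_head i I).
have [u hu uc] := codeq_supported c; rewrite cE in ti uc.
exists (s ++ t ++ u); first by do 2 apply: supported_cat => //.
move=> j; rewrite !mem_cat inE => /predU1P[->|/sI[-> ->]] //.
by rewrite ti uc !orbT.
Qed.

Lemma phiP e x y : phi e x y <-> exists w, run w e x y.
Proof.
split => [h|[w /run_phi //]].
have [|w /(_ _ (mem_head _ _)) ?] := @phi_run [:: (x, y)] e; last by exists w.
by move=> i; rewrite inE => /eqP ->.
Qed.

Lemma decidable_valid f : computable f -> decidable_pred (fun n => valid (f n)).
Proof. by move=> hf; apply: (decidable_comp _ hf); rewrite /valid; comptac. Qed.
#[local] Hint Resolve decidable_valid : comp.

Lemma decidable_run f g h k :
  computable f -> computable g -> computable h -> computable k ->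
  decidable_pred (fun n => run (f n) (g n) (h n) (k n)).
Proof. by rewrite /run /fact /codeq => *; comptac. Qed.
#[local] Hint Resolve decidable_run : comp.

(** * Indices of enumerations, and undecidability of the halting problem *)

Fixpoint const_code k := if k is k'.+1 then CComp CSucc (const_code k') else
  CZero.

Lemma computes_const_code k x y : computes (const_code k) x y <-> y = k.
Proof.
elim: k y => [|k IH] y //=; split; first by move=> [z [/IH -> ->]].
by move=> ->; exists k; split => //; apply/IH.
Qed.

Lemma computable_const_code : computable (fun k => code_num (const_code k)).
Proof.
have h := @computable_rec (fun=> cpair 0 0)
  (fun _ _ r => cpair 5 (cpair (cpair 1 0) r)) (fun n => n).
apply: computable_ext (h _ _ _); [|comptac|comptac|comptac].
by elim=> //= n <-.
Qed.

Lemma code_num_inj : injective code_num.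
Proof.
elim=> [||||f hf g hg|f hf g hg|f hf g hg|f hf] [||||f' g'|f' g'|f' g'|f'] //=
  /cpair_inj[] //.
1-3: by move=> _ /cpair_inj[/hf -> /hg ->].
by move=> _ /hf ->.
Qed.

Lemma phi_code c x y : phi (code_num c) x y <-> computes c x y.
Proof.
by split => [[d /code_num_inj ->] //|h]; exists c.
Qed.

Lemma computes_det c x y z : computes c x y -> computes c x z -> y = z.
Proof.
elim: c x y z => [||||f hf g hg|f hf g hg|f hf g hg|f hf] x y z /=;
  try by move=> -> ->.
- by move=> [a [b [fa gb ->]]] [a' [b' [fa' gb' ->]]];
    rewrite (hf _ _ _ fa fa') (hg _ _ _ gb gb').
- move=> [a [ga fa]] [b [gb fb]]; rewrite (hg _ _ _ ga gb) in fa.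
  exact: hf fa fb.
- move=> [s [s0 sS ->]] [t [t0 tS ->]].
  have H i : i <= csnd x -> s i = t i.
    elim: i => [_|i IH ix]; first exact: hf s0 t0.
    by have := sS i ix; rewrite (IH (ltnW ix)) => /hg; apply; exact: tS.
  exact: H.
- move=> [y0 yS] [z0 zS]; case: (ltngtP y z) => // [/zS|/yS] [u hu].
    by have := hf _ _ _ y0 hu.
  by have := hf _ _ _ z0 hu.
Qed.

Lemma computes_graph c g x y : (forall n, computes c n (g n)) ->
  computes c x y <-> y = g x.
Proof.
by move=> h; split => [/computes_det|->]; [apply|exact: h].
Qed.

(* The s-m-n theorem for programs enumerating [F] along a decidable [P]. *)
Lemma uniform_enumeration (P : nat -> bool) (F : nat -> nat) :
  decidable_pred P -> computable F ->
  exists2 s, computable s & forall p, phi_range (s p) =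
    [set y | exists2 i, P (cpair p i) & y = F (cpair p i)]%classic.
Proof.
move=> hP [cF hF].
have [cP hcP] : decidable_pred (fun z => ~~ P (cfst z)).
  by apply: decidable_not; apply: decidable_comp hP _; comptac.
pose id := CPair CFst CSnd.
have idE x y : computes id x y <-> y = x.
  apply: (computes_graph (g := fun x => x)) => n /=.
  by exists (cfst n), (csnd n); rewrite cpair_eta.
(* [cP] ignores the search variable, so [CMu cP] returns 0 where [P] holds and diverges elsewhere;
   [c] is thus [F] restricted to [P]. *)
pose c := CComp cF (CComp CFst (CPair id (CMu cP))).
have cE x y : computes c x y <-> P x /\ y = F x.
  split.
    move=> [u [[v [[a [b [/idE -> [hb _] ->]]] ->]]]].
    rewrite cfst_cpair => /(computes_graph _ _ hF) ->; split => //.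
    by move/(computes_graph _ _ hcP): hb; rewrite cfst_cpair; case: (P x).
  move=> [Px ->]; exists x; split; last exact: hF.
  exists (cpair x 0); split; last by rewrite /= cfst_cpair.
  exists x, 0; split => //; first exact/idE.
  by split => //; apply/(computes_graph _ _ hcP); rewrite cfst_cpair Px.
(* The parameter is hard-wired through a constant program, whose number is computable from [p]. *)
exists (fun p => code_num (CComp c (CPair (const_code p) id))).
  have h := computable_const_code; rewrite /code_num -/code_num; comptac.
move=> p; apply/seteqP; split => y.
  move=> [i /phi_code [z [[a [b [/computes_const_code -> /idE -> ->]]]]]].
  by move=> /cE[]; exists i.
move=> [i Pi ->]; exists i; apply/phi_code; exists (cpair p i); split.
  by exists p, i; split => //; [exact/computes_const_code|exact/idE].
exact/cE.
Qed.

Lemma ce_exists (P : nat -> bool) (Q : nat -> Prop) : decidable_pred P ->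
  (forall n, Q n <-> exists w, P (cpair n w)) -> ce Q.
Proof.
move=> /decidable_not [c hc] hQ; exists (CMu c) => n; rewrite hQ; split.
  move=> /(@ex_minnP (fun w => P (cpair n w))) [w Pw wmin].
  exists w; split => /=; first by apply/(computes_graph _ _ hc); rewrite Pw.
  move=> i iw; exists 0; apply/(computes_graph _ _ hc).
  by case E : (P _) => //; have := wmin _ E; rewrite leqNgt iw.
move=> [w [/(computes_graph _ _ hc) h _]]; exists w.
by case: (P _) h.
Qed.

Definition halts e w := has (fun y => run w e e y) (iota 0 w).

Lemma decidable_halts f g : computable f -> computable g ->
  decidable_pred (fun n => halts (f n) (g n)).
Proof.
move=> hf hg; have H : decidable_pred (fun z => halts (cfst z) (csnd z)).
  by rewrite /halts; comptac.
apply: decidable_ext (decidable_comp H (computable_pair hf hg)) => n.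
by rewrite !cpairE.
Qed.
#[local] Hint Resolve decidable_halts : comp.

Lemma haltsP e : (exists w, halts e w) <-> exists y, phi e e y.
Proof.
split => [[w /has_iotaP[y _ /run_phi]]|[y /phiP[w h]]]; first by exists y.
exists w; apply/has_iotaP; exists y => //; case/and3P: h => _ _ /fact_lt.
by case.
Qed.

Lemma halting_undecidable (D : nat -> bool) : decidable_pred D ->
  ~ (forall e, D e <-> exists w, halts e w).
Proof.
move=> hD H.
have [c hc] : decidable_pred (fun z => D (cfst z))
  by apply: decidable_comp hD _; comptac.
(* The diagonal program: on input [e], [CMu c] halts exactly when [D e] is false. *)
have := H (code_num (CMu c)); rewrite haltsP; case DE : (D _) => -[h1 h2].
  have [y /phi_code [/(computes_graph _ _ hc)]] := h1 isT.
  by rewrite cfst_cpair DE.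
suff: false by []; apply: h2; exists 0; apply/phi_code; split => //=.
by apply/(computes_graph _ _ hc); rewrite cfst_cpair DE.
Qed.

Local Open Scope classical_set_scope.
Local Open Scope ring_scope.

(** * Cantor space *)

(** For a downward closed [P] the sum is a bounded search for the first failure. [common_prefix] and
    [level] are written as such sums, so that their computability is an instance of closure under
    sums. *)
Lemma lt_sum_downclosed (P : nat -> bool) k n :
  (forall i j, (i <= j)%N -> P j -> P i) ->
  (n < \sum_(0 <= i < k) P i)%N = (n < k)%N && P n.
Proof.
move=> dP; elim: k => [|k IH]; first by rewrite big_geq.
rewrite big_nat_recr //=; case Pk : (P k).
  have -> : (\sum_(0 <= i < k) P i = k)%N.
    rewrite -[RHS]subn0 -[RHS]muln1 -sum_nat_const_nat.
    by apply: eq_big_nat => i /andP[_ ik]; rewrite (dP i k) // ltnW.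
  rewrite addn1; case: ltnP => //=; rewrite ltnS => nk.
  by rewrite (dP n k).
rewrite addn0 IH [in RHS]ltnS [in RHS]leq_eqVlt;
  case: (eqVneq n k) => [->|_] //=.
by rewrite Pk !andbF.
Qed.

(* The first [n] bits of [x], read as a number with [x 0] least significant. *)
Fixpoint pval n (x : nat -> bool) : nat :=
  if n is m.+1 then (pval m x + x m * 2 ^ m)%N else 0.

Lemma pval_lt n x : (pval n x < 2 ^ n)%N.
Proof.
elim: n => //= n IH; rewrite expnS mul2n -addnn -addSn leq_add //.
by case: (x n); rewrite ?mul1n.
Qed.

Lemma pval_mod m n x : (m <= n)%N -> (pval n x %% 2 ^ m = pval m x)%N.
Proof.
elim: n => [|n IH]; first by rewrite leqn0 => /eqP ->; rewrite mod0n.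
rewrite leq_eqVlt => /predU1P[->|]; first by rewrite modn_small // pval_lt.
rewrite ltnS => mn /=; rewrite -modnDmr -modnMmr.
have /eqP -> : (2 ^ m %| 2 ^ n)%N by rewrite dvdn_exp2l.
by rewrite muln0 mod0n addn0 IH.
Qed.

Lemma pval_eqP n x y :
  reflect (forall i, (i < n)%N -> x i = y i) (pval n x == pval n y).
Proof.
apply: (iffP eqP) => [E|H]; last first.
  by elim: n H => //= n IH H; rewrite IH ?H // => i /ltnW; exact: H.
move=> i ilt; have := pval_mod x ilt; have := pval_mod y ilt.
rewrite E => -> /=; have := pval_mod x (ltnW ilt);
  have := pval_mod y (ltnW ilt).
rewrite E => -> -> /addnI /eqP; rewrite eqn_pmul2r ?expn_gt0 //.
by case: (x i) (y i) => [] [].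
Qed.

Definition bits (v : nat) : nat -> bool := fun j => odd (v %/ 2 ^ j).

Lemma modn_double v p : (0 < p)%N ->
  (v %% (2 * p) = v %% p + odd (v %/ p) * p)%N.
Proof.
move=> p0; have rlt : (v %% p < p)%N by rewrite ltn_pmod.
rewrite {1}(divn_eq v p) {1}(divn_eq (v %/ p) 2) modn2 mulnDl -mulnA -addnA.
rewrite modnMDl modn_small 1?addnC //.
by case: (odd _); rewrite ?mul1n ?mul0n; lia.
Qed.

Lemma pval_bits n v : (pval n (bits v) = v %% 2 ^ n)%N.
Proof.
elim: n => [|n IH] /=; first by rewrite modn1.
by rewrite IH expnS modn_double ?expn_gt0.
Qed.

Section cantor_metric.
Context {R : realType}.

Definition cdist (x y : nat -> bool) : R :=
  if pselect (exists n, x n != y n) is left h then 2 ^- ex_minn h else 0.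

(** Distinct points have distance 2^-v with [v] the length of their longest common prefix; the
    metric axioms are all derived from this description. *)
Lemma cdist_cases x y :
  (x = y /\ cdist x y = 0) \/
  exists2 v, cdist x y = 2 ^- v & forall n, (pval n x == pval n y) = (n <= v)%N.
Proof.
rewrite /cdist; case: pselect => [h|h]; [right|left].
  case: ex_minnP => v xv vmin; exists v => // n;
    apply/pval_eqP/idP => [H|nv i ilt].
    by rewrite leqNgt; apply/negP => /H E; rewrite E eqxx in xv.
  by apply: contraTeq (leq_trans ilt nv) => /vmin; rewrite -leqNgt.
split=> //; apply/funext => n; apply/eqP/negPn/negP => xn; apply: h.
by exists n.
Qed.

Lemma ler_expN2 m n : ((2 ^- m : R) <= 2 ^- n) = (n <= m)%N.
Proof.
by rewrite lef_pV2 ?posrE ?exprn_gt0 // ler_eXn2l // ltr1n.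
Qed.

(** A radius matters only through the least [N] with 2^-N < r, so every ball is the class of points
    sharing [N] bits with its centre. *)
Lemma cdist_lt (N : nat) (r : R) x y : (forall k, (2 ^- k < r) = (N <= k)%N) ->
  (cdist x y < r) = (pval N x == pval N y).
Proof.
move=> H; case: (cdist_cases x y) => [[-> ->]|[v -> ->]] //.
rewrite eqxx; apply: lt_trans (_ : 2 ^- N < r); last by rewrite H.
by rewrite invr_gt0 exprn_gt0.
Qed.

Lemma cdist_le n x y : (cdist x y <= 2 ^- n) = (pval n x == pval n y).
Proof.
case: (cdist_cases x y) => [[-> ->]|[v -> ->]]; last by rewrite ler_expN2.
by rewrite eqxx invr_ge0 exprn_ge0.
Qed.

Lemma cdistxx x : cdist x x = 0.
Proof.
by case: (cdist_cases x x) => [[]|[v _ /(_ v.+1)]] //; rewrite eqxx ltnn.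
Qed.

Lemma cdist_eq0 x y : cdist x y = 0 -> x = y.
Proof.
case: (cdist_cases x y) => [[]//|[v -> _] /eqP].
by rewrite invr_eq0 expf_eq0 pnatr_eq0 andbF.
Qed.

Lemma cdist_sym x y : cdist x y = cdist y x.
Proof.
suff H u v : cdist u v <= cdist v u by apply/eqP; rewrite eq_le !H.
case: (cdist_cases v u) => [[-> ->]|[n -> h]] //.
by rewrite cdist_le eq_sym h.
Qed.

(** In the case of three distances the argument is ultrametric: the left side is bounded by the
    larger of the two summands. *)
Lemma cdist_triangle y x z : cdist x z <= cdist x y + cdist y z.
Proof.
case: (cdist_cases x y) => [[<- ->]|[u -> hu]]; first by rewrite add0r.
case: (cdist_cases y z) => [[<- ->]|[v -> hv]].
  by rewrite addr0 cdist_le hu.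
have [uv|/ltnW vu] := leqP u v.
  rewrite (@le_trans _ _ (2 ^- u)) ?lerDl ?invr_ge0 ?exprn_ge0 // cdist_le.
  by have := hv u; rewrite uv => /eqP <-; rewrite hu.
rewrite (@le_trans _ _ (2 ^- v)) ?lerDr ?invr_ge0 ?exprn_ge0 // cdist_le.
by have := hu v; rewrite vu => /eqP ->; rewrite hv.
Qed.

End cantor_metric.

Definition cantorX (R : realType) : Type := nat -> bool.

HB.instance Definition _ (R : realType) :=
  Choice.copy (cantorX R) (nat -> bool).
HB.instance Definition _ (R : realType) :=
  isPointed.Build (cantorX R) (fun=> false).
HB.instance Definition _ (R : realType) := isMetric.Build R (cantorX R)
  cdistxx (@cdist_eq0 R) cdist_sym cdist_triangle.

Section cantor_space.
Context {R : realType}.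
Local Notation X := (cantorX R).

Lemma ltr_expN2 m n : ((2 ^- m : R) < 2 ^- n) = (n < m)%N.
Proof. by rewrite ltNge ler_expN2 -ltnNge. Qed.

Lemma ltr_expN2_double (n k : nat) : ((2 ^- k : R) < 2 / 2 ^+ n) = (n <= k)%N.
Proof.
have -> : (2 ^- k : R) = 2 * 2 ^- k.+1.
  by rewrite exprS invfM mulrA divff ?mul1r // pnatr_eq0.
by rewrite ltr_pM2l // ltr_expN2.
Qed.

Lemma ball_cdist (x y : X) (e : R) : ball x e y = (cdist x y < e).
Proof. by rewrite ballEmdist. Qed.

(** The radius is 2^(1-n) because balls are strict: radius 2^-n would already fix [n.+1] bits. The
    quotient form also covers [n = 0]. *)
Lemma ball_prefix (x y : X) (n : nat) :
  ball x (2 / 2 ^+ n : R) y = (pval n x == pval n y).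
Proof. by rewrite ball_cdist (cdist_lt _ _ (ltr_expN2_double n)). Qed.

Lemma exists_prefix_ball (e : R) : 0 < e ->
  exists n, forall x y : X, pval n x == pval n y -> ball x e y.
Proof.
move=> e0; have [n _ H] : \forall n \near \oo, (2^-1 : R) ^+ n < e.
  have /cvgrPdist_lt/(_ e e0) : (2^-1 : R) ^+ n @[n --> \oo] --> (0 : R).
    by apply: cvg_expr; rewrite ger0_norm // invf_lt1 ?ltr1n.
  by apply: filterS => n; rewrite sub0r normrN ger0_norm // exprn_ge0.
exists n => x y; rewrite -(@cdist_le R) ball_cdist => /le_lt_trans; apply.
by rewrite -exprVn H /=.
Qed.

Let cantor_complete (F : set_system X) : ProperFilter F -> cauchy F -> cvg F.
Proof.
move=> FF /cauchyP /= cF.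
have H n : {x : X | F [set y | pval n.+1 x == pval n.+1 y]}.
  apply: cid; have [|x Fx] := cF (2 / 2 ^+ n.+1);
    first by rewrite divr_gt0 ?exprn_gt0.
  by exists x; apply: filterS Fx => y; rewrite ball_prefix.
(* The filter contains a prefix class of every length; bit [n] of the limit is read from the centre
   of the class of length [n.+1]. *)
pose l : X := fun n => projT1 (H n) n.
have Fl n : F [set y | pval n l == pval n y].
  elim: n => [|n IH]; first by apply: filterE => y; exact: eqxx.
  apply: filterS2 IH (projT2 (H n)) => y /= /eqP E h.
  have /pval_eqP/(_ n (ltnSn n)) En : pval n.+1 (projT1 (H n)) == pval n.+1 y
    by [].
  by rewrite E -En.
apply: (cvgP l); apply/fcvg_ballP => e /exists_prefix_ball [n hn].
by apply: filterS (Fl n) => y; exact: hn.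
Qed.

HB.instance Definition _ := Uniform_isComplete.Build X cantor_complete.

Definition cantor_point (v : nat) : X := bits v.

Let cantor_point_dense : dense (range cantor_point).
Proof.
move=> O [x Ox] oO; have := open_nbhs_nbhs (conj oO Ox).
move=> /nbhs_ballP [e /= e0 xO]; have [n hn] := exists_prefix_ball e0.
exists (bits (pval n x)); split; last by exists (pval n x).
by apply: xO; apply: hn; rewrite pval_bits modn_small // pval_lt.
Qed.

(** Length of the longest common prefix of the expansions of [a != b]. The range [a + b] is long
    enough: both numbers are below 2^(a+b), so prefixes of that length determine them. *)
Definition common_prefix a b :=
  (\sum_(0 <= j < a + b) (a %% 2 ^ j.+1 == b %% 2 ^ j.+1))%N.

Lemma cdist_bits a b :
  (cdist (bits a) (bits b) : R) = if a == b then 0 else 2 ^- common_prefix a b.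
Proof.
case: eqVneq => [->|ab]; first exact: cdistxx.
have H n : (pval n (bits a) == pval n (bits b)) = (n <= common_prefix a b)%N.
  rewrite !pval_bits; case: n => [|n]; first by rewrite !modn1.
  rewrite lt_sum_downclosed => [|i j ij /eqP E].
    case: ltnP => //= abn; apply/negbTE; apply: contra ab.
    have lt : (a + b < 2 ^ n.+1)%N.
      by rewrite (leq_ltn_trans abn) // (ltn_trans (ltnSn n)) // ltn_expl.
    by rewrite !modn_small // (leq_ltn_trans _ lt) ?leq_addr ?leq_addl.
  have d : (2 ^ i.+1 %| 2 ^ j.+1)%N by rewrite dvdn_exp2l.
  by rewrite -(modn_dvdm a d) E modn_dvdm.
apply/eqP; rewrite eq_le cdist_le H leqnn /=.
case: (cdist_cases (R := R) (bits a) (bits b)) => [[E _]|[v -> hv]].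
  by have := H (common_prefix a b).+1; rewrite E eqxx ltnn.
by rewrite ler_expN2 -H hv.
Qed.

Lemma ratr_rat_num n : (ratr (rat_num n) : R) =
  ((cfst n)%:R - (cfst (csnd n))%:R) / (csnd (csnd n)).+1%:R.
Proof. by rewrite /rat_num fmorph_div rmorphB /= !ratr_nat. Qed.

Lemma ratr_dyadic a n : (ratr (rat_num (cpair a (cpair 0 (2 ^ n).-1))) : R) =
  a%:R / 2 ^+ n.
Proof. by rewrite ratr_rat_num !cpairE subr0 prednK ?expn_gt0 // natrX. Qed.

Let cantor_point_dist : computable_reals
  (fun n => mdist (cantor_point (cfst n)) (cantor_point (csnd n)) : R).
Proof.
exists (fun z => if cfst (cfst z) == csnd (cfst z) then cpair 0 (cpair 0 (2 ^
  0).-1)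
  else cpair 1 (cpair 0 (2 ^ common_prefix (cfst (cfst z)) (csnd (cfst
    z))).-1)).
  by rewrite /common_prefix; comptac.
move=> i k; rewrite cpairE -[mdist _ _]/(cdist (bits (cfst i)) (bits (csnd i))).
rewrite cdist_bits; case: eqVneq => _; rewrite ratr_dyadic ?mul0r ?mul1r subrr
  normr0.
  by rewrite invr_ge0 exprn_ge0.
by rewrite invr_ge0 exprn_ge0.
Qed.

HB.instance Definition _ := isComputablePolish.Build R X
  cantor_point_dense cantor_point_dist.

End cantor_space.


(** * The fair coin measure *)

Section cylinders.
Context {R : realType}.
Local Notation X := (cantorX R).

(** Reducing [v] modulo 2^n lets every pair of numbers name a nonempty cylinder, so enumerations of
    cylinders need no side condition. *)
Definition cyl n v : set X := [set x | pval n x = v %% 2 ^ n]%N.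

(* The least [n] with [2 ^- n] smaller than the positive rational number [r]. *)
Definition level r : nat :=
  (\sum_(0 <= n < (csnd r).+1) ((cfst r).+1 * 2 ^ n <= (csnd r).+1))%N.

Lemma level_leq r k : (level r <= k)%N = ((csnd r).+1 < (cfst r).+1 * 2 ^ k)%N.
Proof.
rewrite leqNgt /level lt_sum_downclosed => [|i j ij]; last first.
  by apply: leq_trans; rewrite leq_mul2l leq_exp2l ?ij ?orbT.
rewrite negb_and -leqNgt -ltnNge; case: ltnP => //= k0; apply/esym.
rewrite (leq_trans (leq_ltn_trans k0 (ltn_expl k (ltnSn 1)))) //.
by rewrite leq_pmull.
Qed.

Lemma ltr_expN2_posrat r k :
  ((2 ^- k : R) < ratr (posrat_num r)) = (level r <= k)%N.
Proof.
rewrite level_leq /posrat_num fmorph_div /= !ratr_nat.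
rewrite ltr_pdivlMr ?ltr0n // ltr_pdivrMl ?exprn_gt0 //.
by rewrite -natrX -natrM ltr_nat mulnC.
Qed.

Lemma cball_cyl j : @cball R X j = cyl (level (csnd j)) (cfst j).
Proof.
apply/seteqP; split => x; rewrite /cball /cyl /= ball_cdist
  (cdist_lt _ _ (ltr_expN2_posrat (csnd j))) pval_bits.
  by move=> /eqP.
by move=> ->.
Qed.

(** Index of a ball of radius 2 / 2^n, the radius of [ball_prefix]; the predecessor is there because
    [posrat_num] adds one to the stored denominator. *)
Definition cyl_ball n v := cpair v (cpair 1 (2 ^ n).-1).

Lemma level_cyl_ball n : level (cpair 1 (2 ^ n).-1) = n.
Proof.
suff H k : (level (cpair 1 (2 ^ n).-1) <= k)%N = (n <= k)%N.
  by apply/eqP; rewrite eqn_leq H leqnn /= -H.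
rewrite level_leq !cpairE prednK ?expn_gt0 // -expnS ltn_exp2l //.
Qed.

Lemma cball_cyl_ball n v : @cball R X (cyl_ball n v) = cyl n v.
Proof. by rewrite cball_cyl !cpairE level_cyl_ball. Qed.

Lemma open_prefix n (A : set X) :
  (forall x y, pval n x = pval n y -> A x -> A y) -> open A.
Proof.
move=> H; rewrite openE => x Ax; apply/nbhs_ballP.
exists (2 / 2 ^+ n) => /=; first by rewrite divr_gt0 ?exprn_gt0.
by move=> y; rewrite ball_prefix => /eqP E; apply: H Ax.
Qed.

Lemma open_cyl n v : open (cyl n v).
Proof. by apply: (@open_prefix n) => x y E; rewrite /cyl /= E. Qed.

Lemma cyl_self n (x : X) : cyl n (pval n x) x.
Proof. by rewrite /cyl /= modn_small // pval_lt. Qed.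

Lemma ceopen_cyl e : @ceopen R X e =
  \bigcup_(j in phi_range e) cyl (level (csnd j)) (cfst j).
Proof. by apply: eq_bigcupr => j _; exact: cball_cyl. Qed.

Lemma open_bigcup_cyl (U : set X) : open U ->
  U = \bigcup_(k in [set k | cyl (cfst k) (csnd k) `<=` U]) cyl (cfst k) (csnd
    k).
Proof.
move=> oU; apply/seteqP; split => [x Ux|x [k /= kU kx]]; last exact: kU.
have := open_nbhs_nbhs (conj oU Ux) => /nbhs_ballP [e /= e0 xU].
have [n hn] := exists_prefix_ball e0.
exists (cpair n (pval n x)); rewrite /= !cpairE; last exact: cyl_self.
move=> y; rewrite /cyl /= => E; apply: xU; apply: hn.
by rewrite E modn_small // pval_lt.
Qed.

Lemma borel_open (U : set X) : open U -> measurable (U : set (borel X)).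
Proof. by move=> oU; exact: (@sub_sigma_algebra _ setT (@open X)). Qed.

Lemma measurable_cyl n v : measurable (cyl n v : set (borel X)).
Proof. by apply: borel_open; exact: open_cyl. Qed.

Lemma measurable_ceopen e : measurable (@ceopen R X e : set (borel X)).
Proof.
apply: borel_open; rewrite ceopen_cyl; apply: bigcup_open => j _.
exact: open_cyl.
Qed.

End cylinders.

(** * The coin measure as the image of Lebesgue measure under binary expansion *)

Section coin_measure.
Context {R : realType}.
Local Notation X := (cantorX R).

Fixpoint digit j (t : R) : bool :=
  if j is j'.+1 then digit j' (2 * t - (2^-1 <= t)%R%:R) else 2^-1 <= t.

Definition digits (t : R) : X := fun j => digit j t.

Lemma digits_prefix n (x : nat -> bool) : exists2 a : R, 0 <= a /\ a + 2 ^- n <=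
  1 &
  forall t, 0 <= t < 1 ->
    (forall i, (i < n)%N -> digit i t = x i) <-> a <= t < a + 2 ^- n.
Proof.
elim: n x => [|n IH] x.
  by exists 0; rewrite ?expr0 ?invr1 ?add0r // => t t01; split.
have [a [a0 a1] H] := IH (fun i => x i.+1).
(* The first digit selects a half of the unit interval, and the doubling map carries that half onto
   the interval of the remaining digits; [a] is pulled back along it. *)
exists ((a + (x 0)%:R) / 2).
  rewrite exprS invfM; split; first by rewrite divr_ge0 ?addr_ge0 ?ler0n.
  by case: (x 0) => /=; lra.
move=> t /andP[t0 t1]; rewrite exprS invfM.
have pos : 0 < 2 ^- n :> R by rewrite invr_gt0 exprn_gt0.
have step : (digit 0 t = x 0 /\ a <= 2 * t - (x 0)%:R < a + 2 ^- n) <->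
    (a + (x 0)%:R) / 2 <= t < (a + (x 0)%:R) / 2 + 2^-1 * 2 ^- n.
  rewrite /=; case: (x 0) => /=; split.
  - by move=> [_ /andP[? ?]]; apply/andP; split; lra.
  - by move=> /andP[? ?]; split; [|apply/andP; split]; lra.
  - by move=> [_ /andP[? ?]]; apply/andP; split; lra.
  - move=> /andP[? ?]; split; last by apply/andP; split; lra.
    by apply/negbTE; rewrite -ltNge; lra.
rewrite -step; split => [h|[h0 h] [_|i]] //.
  have h0 := h 0 isT; split=> //; apply/H.
    by rewrite -h0 /=; case: (leP 2^-1 t) => /= ?; apply/andP; split; lra.
  by move=> i ilt; rewrite -(h i.+1) //= -h0.
have r01 : 0 <= 2 * t - (x 0)%:R < 1.
  by rewrite -h0 /=; case: (leP 2^-1 t) => /= ?; apply/andP; split; lra.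
have [_ /(_ h) hi] := H _ r01.
by rewrite ltnS => /hi; rewrite -h0.
Qed.

Let I01 : set R := [set` `[0, 1[].

Lemma digits_cyl n v : exists2 a : R, 0 <= a /\ a + 2 ^- n <= 1 &
  I01 `&` digits @^-1` cyl n v = [set` `[a, a + 2 ^- n[].
Proof.
have [a a01 H] := digits_prefix n (bits v); exists a => //.
have cylE t : cyl n v (digits t) <-> forall i, (i < n)%N -> digit i t =
  bits v i.
  rewrite /cyl /= -pval_bits; split => [/eqP/pval_eqP //|h].
  exact/eqP/pval_eqP.
apply/seteqP; split => t; rewrite /I01 /= !in_itv /=.
  by move=> [t01 /cylE/(H _ t01)].
move=> at_; have t01 : 0 <= t < 1.
  by move: at_ => /andP[? ?]; case: a01 => ? ?; apply/andP; split; lra.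
by split => //; apply/cylE/(H _ t01).
Qed.

Lemma measurable_digits (A : set (borel X)) : measurable A ->
  measurable (I01 `&` digits @^-1` A).
Proof.
have mI : measurable I01 by exact: measurable_itv.
suff : measurable_fun I01 (digits : R -> borel X) by move=> /(_ mI A).
apply: (@measurability _ _ _ (borel X) I01 (digits :
  R -> borel X) (@open X)) => //.
move=> _ [U /open_bigcup_cyl -> <-].
rewrite preimage_bigcup setI_bigcupr; apply: bigcup_measurable => k _.
by have [a _ ->] := digits_cyl (cfst k) (csnd k); exact: measurable_itv.
Qed.

Definition coin (A : set (borel X)) : \bar R :=
  lebesgue_measure (I01 `&` digits @^-1` A).

Let coin0 : coin set0 = 0%E.
Proof. by rewrite /coin preimage_set0 setI0 measure0. Qed.

Let coin_ge0 A : (0 <= coin A)%E.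
Proof. exact: measure_ge0. Qed.

Let coin_sigma_additive : semi_sigma_additive coin.
Proof.
move=> F mF tF mUF; rewrite /coin preimage_bigcup setI_bigcupr.
apply: measure_semi_sigma_additive.
- by move=> n; exact: measurable_digits.
- apply/trivIsetP => /= i j _ _ ij; apply/seteqP; split => // t.
  move=> [[_ Fi] [_ Fj]]; have : (F i `&` F j) (digits t) by split.
  by move/trivIsetP : tF => /(_ _ _ _ _ ij) ->.
- rewrite -setI_bigcupr -preimage_bigcup; exact: measurable_digits.
Qed.

HB.instance Definition _ := isMeasure.Build _ _ _ coin
  coin0 coin_ge0 coin_sigma_additive.

Lemma coin_cyl n v : coin (cyl n v) = (2 ^- n)%:E.
Proof.
rewrite /coin; have [a _ ->] := digits_cyl n v.
rewrite lebesgue_measure_itv /= lte_fin ltrDl invr_gt0 exprn_gt0 //.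
by rewrite -EFinD addrC addKr.
Qed.

Let coin_setT : coin [set: X] = 1%E.
Proof.
have <- : cyl 0 0 = [set: X] by apply/seteqP; split.
by rewrite coin_cyl expr0 invr1.
Qed.

HB.instance Definition _ := Measure_isProbability.Build _ _ _ coin coin_setT.

(** Turns the measure of an event decided by [N] bits into a count of prefixes; the exact and
    effective measure computations rest on it. *)
Lemma coin_prefix (P : nat -> bool) N :
  coin [set x | P (pval N x)] =
  ((\sum_(0 <= w < 2 ^ N) P w)%:R / 2 ^+ N)%:E.
Proof.
(* Bounding the prefix by [M] allows an induction that adds a single cylinder at a time. *)
suff H M : (M <= 2 ^ N)%N ->
    coin [set x | P (pval N x) && (pval N x < M)%N] =
    ((\sum_(0 <= w < M) P w)%:R / 2 ^+ N)%:E.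
  rewrite -H //; congr (coin _); apply/seteqP.
  by split => x /=; rewrite pval_lt andbT.
elim: M => [_|M IH MN].
  rewrite big_geq // mul0r -[RHS]coin0; congr coin.
  by apply/seteqP; split => x //=; rewrite ltn0 andbF.
rewrite big_nat_recr //= natrD mulrDl EFinD -IH 1?ltnW //.
have cylM : cyl N M = [set x : X | pval N x = M].
  by rewrite /cyl modn_small.
have mP K : measurable ([set x | P (pval N x) && (pval N x < K)%N] :
  set (borel X)).
  by apply: borel_open; apply: (@open_prefix _ N) => x y /= ->.
case PM : (P M) => /=.
  have -> : (1 / 2 ^+ N)%:E = coin (cyl N M) by rewrite coin_cyl div1r.
  rewrite -measureU //; last 2 first.
  - exact: measurable_cyl.
  - rewrite cylM; apply/seteqP; split => x //= -[/andP[_ +] E].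
    by rewrite E ltnn.
  congr coin; rewrite cylM; apply/seteqP; split => x /=.
    move=> /andP[Px]; rewrite ltnS leq_eqVlt => /predU1P[->|xM]; first by right.
    by left; rewrite Px.
  by case=> [/andP[-> /ltnW]|->]; rewrite ?PM ltnS ?leqnn.
rewrite mul0r adde0; congr coin; apply/seteqP; split => x /=.
  move=> /andP[Px]; rewrite ltnS leq_eqVlt => /predU1P[E|->]; rewrite ?Px //.
  by rewrite E PM in Px.
by move=> /andP[-> /ltnW]; rewrite ltnS.
Qed.

End coin_measure.

Lemma computable_level f : computable f -> computable (fun n => level (f n)).
Proof. by apply: computable_comp; rewrite /level; comptac. Qed.
#[local] Hint Resolve computable_level : comp.

(** * Counting prefixes in finite unions of cylinders *)

Section cylinder_lists.
Variables n v : nat -> nat.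
Local Open Scope nat_scope.

Definition in_list s w :=
  has (fun k => smem k s && (w %% 2 ^ n k == v k %% 2 ^ n k)) (iota 0 s).

(** A prefix length that decides all cylinders listed in [s]. Any common upper bound of their
    lengths serves, and a sum is already known to be computable. *)
Definition depth s := \sum_(0 <= k < s) smem k s * n k.

(** The length exceeds [depth s] by exactly [m], so that conditioning on a cylinder of length [m], a
    multiplication by 2^m, leaves the denominator [2 ^ depth s]. *)
Definition list_count s m u := \sum_(0 <= w < 2 ^ (depth s + m))
  (in_list s w && (w %% 2 ^ m == u %% 2 ^ m)).

Lemma depth_ge s k : smem k s -> n k <= depth s.
Proof.
move=> ks; rewrite /depth (bigD1_seq k) ?mem_index_iota ?iota_uniq ?smem_lt //=.
by rewrite ks mul1n leq_addr.
Qed.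

Hypotheses (cn : computable n) (cv : computable v).

Lemma computable_depth f : computable f -> computable (fun z => depth (f z)).
Proof.
move=> hf; apply: computable_comp hf; rewrite /depth.
have h : computable (fun z => n (csnd z)) by apply: computable_comp; comptac.
by comptac.
Qed.

Lemma computable_list_count f g h :
  computable f -> computable g -> computable h ->
  computable (fun z => list_count (f z) (g z) (h z)).
Proof.
move=> hf hg hh; rewrite /list_count /in_list.
have := computable_depth hf.
have hn : computable (fun z => n (csnd z)) by apply: computable_comp; comptac.
have hv : computable (fun z => v (csnd z)) by apply: computable_comp; comptac.
(* Each nested sum or bounded quantifier pairs the parameter with a bound variable, so the functions
   are needed after as many projections as there are binders. *)
have hf1 : computable (fun z => f (cfst z)) by apply: computable_comp; comptac.
have hg1 : computable (fun z => g (cfst z)) by apply: computable_comp; comptac.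
have hh1 : computable (fun z => h (cfst z)) by apply: computable_comp; comptac.
have hf2 : computable (fun z => f (cfst (cfst z))) by apply: computable_comp;
  comptac.
by comptac.
Qed.

End cylinder_lists.

(** * The computable basis, the prefix filtration and lower bounds on measures *)

Section coin_effective.
Context {R : realType}.
Local Notation X := (cantorX R).
Local Notation nu := (@coin R : probability (borel X) R).

Lemma cyl_mod n v N (x : X) : (n <= N)%N ->
  cyl n v x <-> (pval N x %% 2 ^ n == v %% 2 ^ n)%N.
Proof. by move=> nN; rewrite pval_mod //; split => [->|/eqP]. Qed.

Lemma coin_list n v s m u :
  nu ((\bigcup_(k in [set k | smem k s]) cyl (n k) (v k)) `&` cyl m u) =
  ((list_count n v s m u)%:R / 2 ^+ (depth n s + m))%:E.
Proof.
rewrite -(coin_prefix (fun w => in_list n v s w && (w %% 2 ^ m ==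
  u %% 2 ^ m))%N).
have le k : smem k s -> (n k <= depth n s + m)%N.
  by move=> ks; rewrite (leq_trans (depth_ge n ks)) ?leq_addr.
congr coin; apply/seteqP; split => x /=.
  move=> [[k ks kx] xm]; apply/andP; split; last first.
    exact/(cyl_mod u x (leq_addl (depth n s) m)).
  apply/has_iotaP; exists k; first exact: smem_lt.
  by rewrite ks /=; apply/(cyl_mod _ x (le k ks)).
move=> /andP[/has_iotaP[k _ /andP[ks kx]] xm]; split; last first.
  exact/(cyl_mod u x (leq_addl (depth n s) m)).
by exists k => //; apply/(cyl_mod _ x (le k ks)).
Qed.

(** The source of all indices of c.e. open sets constructed below: it is enough to present the set
    as a union of cylinders selected by a decidable predicate. *)
Lemma uniform_ceopen (P : nat -> bool) (N V : nat -> nat) :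
  decidable_pred P -> computable N -> computable V ->
  exists2 s, computable s & forall p, @ceopen R X (s p) =
    \bigcup_(i in [set i | P (cpair p i)]) cyl (N (cpair p i)) (V (cpair p i)).
Proof.
move=> hP hN hV.
have [s cs sE] := uniform_enumeration hP
  (computable_pair hV (computable_pair (computable_cst 1)
    (computable_pred (computable_exp 2 hN)))).
exists s => // p; rewrite /ceopen sE; apply/seteqP; split => x.
  by move=> [_ [i Pi ->]]; rewrite -/(cyl_ball _ _) cball_cyl_ball; exists i.
move=> [i Pi xi]; exists (cyl_ball (N (cpair p i)) (V (cpair p i))).
  by exists i.
by rewrite cball_cyl_ball.
Qed.

Lemma cylC n v :
  ~` (cyl n v : set X) = \bigcup_(i in [set i | i %% 2 ^ n !=
    v %% 2 ^ n]%N) cyl n i.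
Proof.
apply/seteqP; split => x; rewrite /cyl /=.
  move=> xv; have E : (pval n x %% 2 ^ n = pval n x)%N
    by rewrite modn_small ?pval_lt.
  by exists (pval n x); rewrite /= E //; apply/eqP.
by move=> [i /= /eqP iv ->].
Qed.

Definition cbasis k : set X := cyl (cfst k) (csnd k).

Lemma ceopen_cbasis : exists2 h, computable h &
  forall e, @ceopen R X e = \bigcup_(k in phi_range (h e)) cbasis k.
Proof.
(* Dovetailing: besides the parameter [e], [z] carries a certificate, an input of the enumeration
   and the ball it outputs. *)
have hP : decidable_pred (fun z => run (cfst (csnd z)) (cfst z)
  (cfst (csnd (csnd z))) (csnd (csnd (csnd z)))) by comptac.
have hF : computable (fun z => cpair (level (csnd (csnd (csnd (csnd z)))))
  (cfst (csnd (csnd (csnd z))))) by comptac.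
have [h ch hE] := uniform_enumeration hP hF.
exists h => // e; rewrite ceopen_cyl hE; apply/seteqP; split => x.
  move=> [j [i /phiP[w r]] xj].
  exists (cpair (level (csnd j)) (cfst j)); last by rewrite /cbasis !cpairE.
  by exists (cpair w (cpair i j)); rewrite !cpairE.
move=> [_ [i + ->]]; rewrite /cbasis !cpairE => r xi.
by exists (csnd (csnd i)) => //; exists (cfst (csnd i)); apply/phiP;
  exists (cfst i).
Qed.

Lemma coin_computable_basis : computable_basis nu cbasis.
Proof.
split.
- have [||//|b cb bE] := @uniform_ceopen (fun=> true) (fun z => cfst (cfst z))
    (fun z => csnd (cfst z)); [by rewrite /decidable_pred;
      comptac|comptac|comptac|].
  exists b => // k; rewrite bE; apply/seteqP; split => x.
    by move=> kx; exists 0 => //; rewrite !cpairE.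
  by move=> [i _]; rewrite !cpairE.
- exact: ceopen_cbasis.
(* The measure is a dyadic rational given exactly, so the error is zero for every precision;
   conditioning on [cyl 0 0] is conditioning on the whole space. *)
- exists (fun z => cpair (list_count cfst csnd (cfst z) 0 0)
    (cpair 0 (2 ^ (depth cfst (cfst z) + 0)).-1))%N.
    have cf : computable cfst by apply: computable_fst; comptac.
    have cs : computable csnd by apply: computable_snd; comptac.
    have hf : computable (fun z => cfst z) by comptac.
    have h1 := computable_list_count cf cs hf (computable_cst 0) (computable_cst
      0).
    have h2 := computable_depth cf hf.
    by comptac.
  move=> s k; rewrite cpairE ratr_dyadic.
  have -> : \bigcup_(i in [set` s]) cbasis i =
      (\bigcup_(k in [set k | smem k (seq_num s)]) cyl (cfst k) (csnd k))
        `&` @cyl R 0 0.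
    have -> : @cyl R 0 0 = [set: X] by apply/seteqP; split.
    rewrite setIT; congr bigcup; apply/seteqP; split => i /=;
    by rewrite smem_seq_num.
  by rewrite coin_list /= subrr normr0 invr_ge0 exprn_ge0.
(* Cylinders are clopen: each is its own effectively closed superset, its complement being the union
   of the other cylinders of the same length. *)
- have [||//|c cc cE] := @uniform_ceopen
    (fun z => (csnd z) %% 2 ^ cfst (cfst z) !=
      csnd (cfst z) %% 2 ^ cfst (cfst z))%N
    (fun z => cfst (cfst z)) csnd; [comptac|comptac|by apply: computable_snd;
      comptac|].
  exists c => // k; suff -> : @ceopen R X (c k) = ~` cbasis k by rewrite setCK;
    split.
  rewrite cE /cbasis cylC; apply/seteqP; split => x [i /=];
    rewrite ?cpairE => h1 h2;
  by exists i; rewrite /= ?cpairE.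
Qed.

Definition cfilt n : set (set X) := <<s range (@cyl R n)>>.

(** Replaces membership in the generated algebra by invariance under the first [n] bits. The
    converse direction writes [A] as a countable union of generators. *)
Lemma cfiltP n (A : set X) : cfilt n A <->
  (forall x y, pval n x = pval n y -> A x -> A y).
Proof.
split.
  move: A; apply: smallest_sub.
    split => //.
    - move=> B hB x y xy [_ nBx]; split => // By; apply: nBx.
      exact: hB (esym xy) By.
    - by move=> B hB x y xy [i _ Bx]; exists i => //; exact: hB xy Bx.
  by move=> _ [v _ <-] x y; rewrite /cyl /= => ->.
move=> hA.
have -> : A = \bigcup_(v in [set v | cyl n v `<=` A]) cyl n v.
  apply/seteqP; split => [x Ax|x [v]]; last by apply.
  exists (pval n x); last exact: cyl_self.
  by move=> y; rewrite /cyl /= modn_small ?pval_lt // => E; apply: hA Ax.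
pose T := g_sigma_algebraType (range (@cyl R n)).
apply: (@bigcup_measurable _ T) => v _.
by apply: sub_sigma_algebra; exists v.
Qed.

Lemma cfilt_filtration : almost_full_effective_filtration nu cfilt.
Proof.
split.
  move=> n A /cfiltP hA; apply/cfiltP => x y E; apply: hA.
  by rewrite -!(@pval_mod n n.+1) ?E.
exists cbasis, (fun n m => cyl n m); split.
- exact: coin_computable_basis.
- exists (fun k => cpair 0 k); first by comptac.
  by move=> n m; exists (BBase (cpair n m)); rewrite //= /cbasis !cpairE.
- by [].
- have [h ch hE] := ceopen_cbasis; exists h => // e; congr (_ `&` _).
  exact: hE.
Qed.

(** Clearing denominators and moving the subtracted part of [q] across leaves a comparison of
    natural numbers, which is decidable. *)
Lemma rat_num_lt q c N : ((ratr (rat_num q) : R) < c%:R / 2 ^+ N) =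
  (cfst q * 2 ^ N < c * (csnd (csnd q)).+1 + cfst (csnd q) * 2 ^ N)%N.
Proof.
rewrite ratr_rat_num ltr_pdivrMr ?ltr0n // mulrAC ltr_pdivlMr ?exprn_gt0 //.
by rewrite mulrBl ltrBlDr -!natrX -!natrM -natrD ltr_nat.
Qed.

(* [w] certifies that the balls listed in [s] are enumerated by [phi e]. *)
Definition listed_by e w s :=
  all (fun j => smem j s ==> has (fun i => run w e i j) (iota 0 w)) (iota 0 s).

(** [w] certifies that [s] lists balls of the open set [e], and the union of these balls already has
    conditional measure above [q] in [cyl n u]. *)
Definition measure_check e n u q w s :=
  listed_by e w s &&
  (cfst q * 2 ^ depth (fun j => level (csnd j)) s <
   list_count (fun j => level (csnd j)) cfst s n u * (csnd (csnd q)).+1 +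
   cfst (csnd q) * 2 ^ depth (fun j => level (csnd j)) s)%N.

(** By continuity from below, a strict lower bound on the measure of the open set is attained by the
    finitely many enumerated balls with index below some [K]; conversely a finite union of
    enumerated balls bounds the measure from below. *)
Lemma measure_checkP e n u q :
  ((ratr (rat_num q) : R)%:E < (2 ^+ n)%:E * nu (ceopen e `&` cyl n u))%E <->
  exists w s, measure_check e n u q w s.
Proof.
pose L s := ((2 ^+ n)%:E *
  nu ((\bigcup_(k in [set k | smem k s]) cyl (level (csnd k)) (cfst k)) `&` cyl
    n u))%E.
have LE s : L s = ((list_count (fun j => level (csnd j)) cfst s n u)%:R /
    2 ^+ depth (fun j => level (csnd j)) s)%:E.
  rewrite /L coin_list -EFinM; congr EFin; rewrite exprD invfM.
  by rewrite mulrCA [2 ^+ n * _]mulrCA divff ?mulr1 // expf_neq0 // pnatr_eq0.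
have LP s w : measure_check e n u q w s <->
    listed_by e w s /\ ((ratr (rat_num q) : R)%:E < L s)%E.
  by rewrite LE lte_fin rat_num_lt; split => [/andP|[h1 h2]] //; apply/andP.
split; last first.
  move=> [w [s /LP[lw /lt_le_trans]]]; apply.
  rewrite /L lee_pmul2l ?lte_fin ?exprn_gt0 //.
  apply: le_measure; rewrite ?inE.
  - apply: measurableI; last exact: measurable_cyl.
    by apply: bigcup_measurable => j _; exact: measurable_cyl.
  - by apply: measurableI; [exact: measurable_ceopen|exact: measurable_cyl].
  apply: setSI; rewrite ceopen_cyl; apply: bigcup_subset => j /= js.
  have /all_iotaP/(_ j (smem_lt js)) := lw; rewrite js /= => /has_iotaP[i _].
  by move=> /run_phi; exists i.
move=> qlt.
pose U K := (\bigcup_(j in phi_range e `&` [set j | (j < K)%N])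
  cyl (level (csnd j)) (cfst j) : set X) `&` cyl n u.
have mU K : measurable (U K : set (borel X)).
  apply: measurableI; last exact: measurable_cyl.
  by apply: bigcup_measurable => j _; exact: measurable_cyl.
have UE : ceopen e `&` cyl n u = \bigcup_K U K.
  rewrite -setI_bigcupl; congr (_ `&` _); rewrite ceopen_cyl.
  apply/seteqP; split => x.
    by move=> [j je jx]; exists j.+1 => //; exists j => //; split => /=.
  by move=> [K _ [j [je _] jx]]; exists j.
have ndU : {homo U : a b / (a <= b)%N >-> (a <= b)%O}.
  move=> a b ab; apply/subsetPset; apply: setSI;
    apply: bigcup_subset => j /= [? ja].
  by split => //=; exact: leq_trans ab.
have cvU : ((2 ^+ n)%:E * nu (U K))%E @[K --> \oo] -->
    ((2 ^+ n)%:E * nu (ceopen e `&` cyl n u))%E.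
  rewrite UE; apply: cvgeZl => //; apply: nondecreasing_cvg_mu => //.
  exact: bigcup_measurable.
have [K _ /(_ K (leqnn K)) KU] : \forall K \near \oo,
    ((ratr (rat_num q) : R)%:E < (2 ^+ n)%:E * nu (U K))%E.
  exact: (cvU _ (open_ereal_gt' qlt)).
(* The list is selected classically: only the existence of a certificate is claimed here. *)
pose J := [seq j <- iota 0 K | `[< phi_range e j >]].
have JE j : j \in J = (j < K)%N && `[< phi_range e j >].
  by rewrite mem_filter mem_iota /= add0n andbC.
have [inp hin] : exists f, forall j, phi_range e j -> phi e (f j) j.
  exists (fun j => xget 0%N [set i | phi e i j]) => j [i h].
  exact: (@xgetPex _ _ [set i | phi e i j]) (ex_intro _ i h).
have [|w hw] := @phi_run [seq (inp j, j) | j <- J] e.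
  by move=> i /mapP[j]; rewrite JE => /andP[_ /asboolP/hin h] ->.
exists w, (seq_num J); apply/LP; split.
  apply/all_iotaP => j _; apply/implyP; rewrite smem_seq_num => jJ.
  have /hw /= r : (inp j, j) \in [seq (inp j, j) | j <- J] by apply/mapP;
    exists j.
  by apply/has_iotaP; exists (inp j) => //; case/and3P: r => _ _ /fact_lt[].
suff -> : L (seq_num J) = ((2 ^+ n)%:E * nu (U K))%E by [].
congr (_ * nu (_ `&` _))%E; congr bigcup; apply/seteqP; split => j /=;
  rewrite smem_seq_num JE.
  by move=> /andP[? /asboolP].
by move=> [? ?]; apply/andP; split => //; exact/asboolP.
Qed.

End coin_effective.

(** * Conditional expectations *)

Lemma decidable_measure_check e n u q w s :
  computable e -> computable n -> computable u -> computable q ->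
  computable w -> computable s ->
  decidable_pred (fun z => measure_check (e z) (n z) (u z) (q z) (w z) (s z)).
Proof.
move=> he hn hu hq hw hs; rewrite /measure_check /listed_by.
have cl : computable (fun j => level (csnd j)) by comptac.
have cf : computable cfst by apply: computable_fst; comptac.
have h1 := computable_list_count cl cf hs hn hu.
have h2 := computable_depth cl hs.
have hs1 : computable (fun z => s (cfst z)) by apply: computable_comp; comptac.
have hw1 : computable (fun z => w (cfst z)) by apply: computable_comp; comptac.
have hw2 : computable (fun z => w (cfst (cfst z))) by apply: computable_comp;
  comptac.
have he2 : computable (fun z => e (cfst (cfst z))) by apply: computable_comp;
  comptac.
by comptac.
Qed.

Section coin_kernel.
Context {R : realType}.
Local Notation X := (cantorX R).
Local Notation nu := (@coin R : probability (borel X) R).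
Local Notation "[ n | x ]" := (@cyl R n (pval n x)) (at level 0, n at level 50).

Lemma coin_computable : computable_measure nu.
Proof.
have hP : decidable_pred (fun z => measure_check (cfst (cfst z)) 0 0
    (csnd (cfst z)) (cfst (csnd z)) (csnd (csnd z))).
  by apply: decidable_measure_check; comptac.
apply: ce_exists hP _ => z.
(* The coin measure is its own conditional measure given the empty prefix. *)
have E : nu (ceopen (cfst z)) = ((2 ^+ 0)%:E * nu (ceopen (cfst z) `&` cyl 0
  0))%E.
  have -> : @cyl R 0 0 = [set: X] by apply/seteqP; split.
  by rewrite setIT expr0 mul1e.
rewrite E measure_checkP; split => [[w [s h]]|[i h]].
  by exists (cpair w s); rewrite !cpairE.
by rewrite !cpairE in h; exists (cfst i), (csnd i).
Qed.

Definition crho n (x : borel X) : {measure set (borel X) -> \bar R} :=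
  mscale (NngNum (exprn_ge0 n (ler0n R 2)))
    (mrestr nu (measurable_cyl n (pval n x))).

Lemma crhoE n x A : crho n x A = ((2 ^+ n)%:E * nu (A `&` [n | x]))%E.
Proof. by []. Qed.

Lemma crho_prefix n x y : pval n x = pval n y -> crho n x = crho n y.
Proof. by rewrite /crho => ->. Qed.

Lemma measurable_fun_prefix (d : measure_display) (T : measurableType d) n
    (g : borel X -> T) :
  (forall x y, pval n x = pval n y -> g x = g y) -> measurable_fun setT g.
Proof.
move=> hg _ Y _; rewrite setTI; apply: borel_open.
by apply: (@open_prefix _ n) => x y E; rewrite /preimage /= (hg _ _ E).
Qed.

Let crho_measurable n (U : set (borel X)) :
  measurable U -> measurable_fun [set: borel X] (crho n ^~ U).
Proof.
move=> _; apply: (@measurable_fun_prefix _ _ n) => x y E.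
by rewrite !crhoE E.
Qed.

HB.instance Definition _ n := isKernel.Build _ _ _ _ _ (crho n)
  (@crho_measurable n).

Lemma coin_cyl_scale n v : ((2 ^+ n)%:E * nu (cyl n v))%E = 1%E.
Proof.
by rewrite [nu _]coin_cyl -EFinM divff // expf_neq0 // pnatr_eq0.
Qed.

(** The conditional measure depends on [x] only through its first [n] bits, so a superlevel set is
    the union of the cylinders [cyl n u] for which some [measure_check] succeeds. *)
Lemma crho_lsc : uniformly_lsc (fun k x => crho (cfst k) x (@ceopen R X (csnd
  k))).
Proof.
split; first by move=> k x; rewrite (lt_le_trans ltNy0) // measure_ge0.
have hP : decidable_pred (fun z => measure_check (csnd (cfst (cfst z)))
    (cfst (cfst (cfst z))) (cfst (csnd z)) (csnd (cfst z))
    (cfst (csnd (csnd z))) (csnd (csnd (csnd z)))).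
  by apply: decidable_measure_check; comptac.
have [||g cg gE] := @uniform_ceopen R _ (fun z => cfst (cfst (cfst z)))
  (fun z => cfst (csnd z)) hP; [comptac|comptac|].
exists g => // k q; rewrite gE; set n := cfst k; set e := csnd k.
apply/seteqP; split => x /=; rewrite crhoE.
  move=> /measure_checkP[w [s h]].
  by exists (cpair (pval n x) (cpair w s)); rewrite /= !cpairE //;
    exact: cyl_self.
move=> [i /=]; rewrite !cpairE -/n -/e => h xi; apply/measure_checkP.
exists (cfst (csnd i)), (csnd (csnd i)); rewrite /measure_check.
suff <- : list_count (fun j => level (csnd j)) cfst (csnd (csnd i)) n (cfst i) =
  list_count (fun j => level (csnd j)) cfst (csnd (csnd i)) n (pval n x) by [].
by rewrite /list_count xi; apply: eq_bigr => j _; rewrite modn_mod.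
Qed.

Lemma KR_bigcap : KR nu =
  ~` \bigcup_(e in [set e | nu (ceopen e) = 1%E]) ~` @ceopen R X e.
Proof.
apply/seteqP; split => x h; first by move=> [e /= e1]; apply; exact: h.
by move=> e e1; apply: contrapT => nx; apply: h; exists e.
Qed.

(** The complement is a countable union of null sets, one for each index of a c.e. open set of
    measure 1. *)
Lemma coin_KR : measurable (KR nu : set (borel X)) /\ nu (~` KR nu) = 0%E.
Proof.
set N := \bigcup_(e in [set e | nu (ceopen e) = 1%E]) ~` @ceopen R X e.
have mN : measurable (N : set (borel X)).
  by apply: bigcup_measurable => e _; apply: measurableC;
    exact: measurable_ceopen.
rewrite KR_bigcap -/N setCK; split; first exact: measurableC.
apply/negligibleP => //; rewrite /N bigcup_mkcond;
  apply: negligible_bigcup => e.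
case: ifPn => [|_]; last exact: negligible_set0.
rewrite inE /= => e1; apply/negligibleP; first by apply: measurableC;
  exact: measurable_ceopen.
apply: etrans (probability_setC nu (@measurable_ceopen R e)) _.
by apply: etrans (congr1 (fun t => 1 - t)%E e1) _; rewrite subee.
Qed.

Lemma same_atom_cfilt n x : same_atom (cfilt n) x = [n | x].
Proof.
apply/seteqP; split => y.
  move=> /(_ [n | x]) h; apply/h; last exact: cyl_self.
  by apply/cfiltP => z t E; rewrite /cyl /= E.
rewrite /cyl /= modn_small ?pval_lt // => E A /cfiltP hA.
by split; apply: hA.
Qed.

Lemma crho_KR n x : crho n x [set: X] = 1%E /\
  crho n x (same_atom (cfilt n) x `&` KR nu) = 1%E.
Proof.
rewrite !crhoE setTI coin_cyl_scale; split => //.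
have [mK K0] := coin_KR.
rewrite same_atom_cfilt setIAC setIid -[RHS](coin_cyl_scale n (pval n x)).
congr (_ * _)%E; apply/esym.
rewrite -[in LHS](setUIDK [n | x] (KR nu)) measureU //; last 3 first.
- by apply: measurableI => //; exact: measurable_cyl.
- by apply: measurableD => //; exact: measurable_cyl.
- by apply/seteqP; split => y // [[_ ?] [_ ?]].
rewrite [X in (_ + X)%E](_ : _ = 0%E) ?adde0 //.
apply/eqP; rewrite eq_le measure_ge0 andbT -K0; apply: le_measure;
  rewrite ?inE //.
- by apply: measurableD => //; exact: measurable_cyl.
- exact: measurableC.
Qed.

(** The kernel measure vanishes off the cylinder of [x] and agrees with 2^n times [nu] inside it;
    the two pieces are integrated separately. *)
Lemma integral_crho_ge0 n x (f : borel X -> \bar R) :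
  measurable_fun setT f -> (forall y, (0 <= f y)%E) ->
  (\int[crho n x]_y f y = (2 ^+ n)%:E * \int[nu]_(y in [n | x]) f y)%E.
Proof.
move=> mf f0; have mC := @measurable_cyl R n (pval n x).
rewrite -(setUv [n | x]) ge0_integral_setU //; last 3 first.
- exact: measurableC.
- by rewrite setUv.
- by apply/disj_setPS; rewrite setICr.
rewrite [X in (_ + X)%E]null_set_integral ?adde0; last 3 first.
- exact: measurableC.
- exact: measurable_funTS.
- by rewrite crhoE setICl measure0 mule0.
rewrite (eq_measure_integral (mscale (NngNum (exprn_ge0 n (ler0n R 2))) nu)).
  by rewrite ge0_integral_mscale //; exact: measurable_funTS.
by move=> A mA AC; rewrite crhoE setIidl.
Qed.

Lemma integral_crho n x (f : borel X -> \bar R) : nu.-integrable setT f ->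
  (\int[crho n x]_y f y = (2 ^+ n)%:E * \int[nu]_(y in [n | x]) f y)%E.
Proof.
move=> fi; have mf := measurable_int _ fi.
have fiC : nu.-integrable [n | x] f.
  by apply: integrableS fi => //; exact: measurable_cyl.
rewrite integralE [in RHS]integralE !integral_crho_ge0 //; last 2 first.
- exact: measurable_funeneg.
- exact: measurable_funepos.
rewrite [RHS]muleBr //; apply: fin_num_adde_defr.
by apply: integrable_pos_fin_num => //; exact: measurable_cyl.
Qed.

Lemma integral_crho_prefix n x y (f : borel X -> \bar R) :
  pval n x = pval n y -> (\int[crho n x]_y f y = \int[crho n y]_y f y)%E.
Proof. by move=> /crho_prefix ->. Qed.

(** The candidate is constant on each cylinder of length [n], with value the average of [f] there,
    and a set of [cfilt n] is a finite disjoint union of such cylinders. *)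
Lemma crho_cond_exp n (f : borel X -> \bar R) : nu.-integrable setT f ->
  is_cond_exp nu (cfilt n) f (fun x => \int[crho n x]_y f y)%E.
Proof.
move=> fi; have mf := measurable_int _ fi.
have fiC v : nu.-integrable (cyl n v) f.
  by apply: integrableS fi => //; exact: measurable_cyl.
set g := fun x => _.
have gE x y : pval n x = pval n y -> g x = g y by exact: integral_crho_prefix.
have mg : measurable_fun [set: borel X] g by exact: measurable_fun_prefix gE.
have gfin x : g x \is a fin_num.
  by rewrite /g integral_crho // fin_numM // integrable_fin_num //;
    exact: measurable_cyl.
split.
- move=> _ Y _; rewrite setTI; apply: sub_sigma_algebra; apply/cfiltP => x y E.
  by rewrite /preimage /= (gE _ _ E).
(* A constant dominating all the averages in absolute value. *)
- pose c := ((2 ^+ n)%:E * \int[nu]_y `|f y|)%E.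
  have cfin : c \is a fin_num by rewrite fin_numM // integrable_fin_num //;
    exact: integrable_abse.
  apply: (@le_integrable _ _ _ _ _ _ _ (cst c)) => //; last first.
    by rewrite -(fineK cfin); exact: finite_measure_integrable_cst.
  move=> x _; rewrite /= /g integral_crho // abseM.
  have -> : `|c|%E = c by rewrite gee0_abs // mule_ge0 ?lee_fin ?exprn_ge0
    ?integral_ge0.
  rewrite gee0_abs ?lee_fin ?exprn_ge0 // lee_pmul2l ?lte_fin ?exprn_gt0 //.
  apply: le_trans (le_abse_integral _ _ _) _;
    [exact: measurable_cyl|exact: measurable_funTS|].
  by apply: ge0_subset_integral => //; [exact: measurable_cyl|exact:
    measurableT_comp].
move=> A /cfiltP hA.
suff H M : (M <= 2 ^ n)%N ->
   (\int[nu]_(x in A `&` [set x | (pval n x < M)%N]) g x =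
    \int[nu]_(x in A `&` [set x | (pval n x < M)%N]) f x)%E.
  have -> : A = A `&` [set x | (pval n x < 2 ^ n)%N].
    by apply/seteqP; split => [x Ax|x []//]; split => //=; exact: pval_lt.
  exact: H.
have mA K : measurable (A `&` [set x | (pval n x < K)%N] : set (borel X)).
  by apply: borel_open; apply: (@open_prefix _ n) => x y /= E [Ax]; rewrite E;
    split => //; exact: hA Ax.
elim: M => [_|M IH MN].
  have -> : A `&` [set x | (pval n x < 0)%N] = set0 by apply/seteqP;
    split => x // [].
  by rewrite !integral_set0.
have cylM : @cyl R n M = [set x | pval n x = M] by rewrite /cyl modn_small.
(* By invariance of [A], the cylinder of [M] is either contained in [A] or disjoint from it. *)
have [[z [Az zM]]|noz] := pselect (exists z, A z /\ pval n z = M); last first.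
  have -> : A `&` [set x | (pval n x < M.+1)%N] =
    A `&` [set x | (pval n x < M)%N].
    apply/seteqP; split => x /= [Ax]; last by move=> /ltnW; rewrite ltnS.
    rewrite ltnS leq_eqVlt => /predU1P[E|//]; exfalso; apply: noz.
    by exists x.
  exact/IH/ltnW.
have -> : A `&` [set x | (pval n x < M.+1)%N] =
    (A `&` [set x | (pval n x < M)%N]) `|` @cyl R n M.
  rewrite cylM; apply/seteqP; split => x /=.
    by move=> [Ax]; rewrite ltnS leq_eqVlt => /predU1P[->|xM]; [right|left].
  case=> [[Ax /ltnW xM]|xM]; first by rewrite ltnS.
  by rewrite xM; split => //; apply: hA Az; rewrite xM.
have mC := @measurable_cyl R n M.
have dj : [disjoint (A `&` [set x | (pval n x < M)%N]) & @cyl R n M].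
  by apply/disj_setPS => x; rewrite cylM => -[[_ /=]] + E; rewrite E ltnn.
rewrite !integral_setU //; [|exact: measurable_funTS|exact: measurable_funTS].
rewrite (IH (ltnW MN)); congr (_ + _)%E.
rewrite (eq_integral (cst (g z))); last first.
  by move=> x; rewrite inE cylM /= => xM; apply: gE; rewrite xM.
rewrite -(fineK (gfin z)) integral_cst // fineK //.
rewrite /g integral_crho // zM muleAC coin_cyl_scale mul1e //.
Qed.

End coin_kernel.

(** * The slowly converging test *)

(* [j = cpair e w] with [w] the least certificate that [phi e e] halts. *)
Definition first_halt j := halts (cfst j) (csnd j) &&
  all (fun w => ~~ halts (cfst j) w) (iota 0 (csnd j)).

Lemma first_halt_inj j k :
  first_halt j -> first_halt k -> cfst j = cfst k -> j = k.
Proof.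
move=> /andP[hj /all_iotaP mj] /andP[hk /all_iotaP mk] E.
suff E' : csnd j = csnd k by rewrite -(cpair_eta j) E E' cpair_eta.
case: (ltngtP (csnd j) (csnd k)) => // h.
  by have := mk _ h; rewrite -E hj.
by have := mj _ h; rewrite E hk.
Qed.

Lemma first_halt_exists e w : halts e w ->
  exists2 w', first_halt (cpair e w') & (w' <= w)%N.
Proof.
move=> h; have [w' hw' wmin] := ex_minnP (ex_intro (halts e) w h).
exists w'; last exact: wmin.
rewrite /first_halt !cpairE hw'; apply/all_iotaP => i iw.
by apply/negP => /wmin; rewrite leqNgt iw.
Qed.

Lemma decidable_first_halt f : computable f ->
  decidable_pred (fun n => first_halt (f n)).
Proof. by move=> hf; apply: (decidable_comp _ hf); rewrite /first_halt;
  comptac. Qed.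
#[local] Hint Resolve decidable_first_halt : comp.

Lemma cfst_leq j : (cfst j <= j)%N.
Proof. by rewrite -{2}(cpair_eta j) (leq_trans _ (cpair_ge _ _)) // leq_addr.
  Qed.

Lemma computable_bits_sum f g : computable f -> computable g ->
  computable (fun z => \sum_(0 <= j < f z)
    (bits (g z) j && first_halt j) * 2 ^ (f z - cfst j))%N.
Proof.
move=> hf hg; have hg1 : computable (fun z => g (cfst z))
  by apply: computable_comp; comptac.
have hf1 : computable (fun z => f (cfst z)) by apply: computable_comp; comptac.
by rewrite /bits; comptac.
Qed.

Section slow_test.
Context {R : realType}.
Local Notation X := (cantorX R).
Local Notation nu := (@coin R : probability (borel X) R).

Definition weight j : R := (first_halt j)%:R / 2 ^+ cfst j.

Lemma weight_ge0 j : 0 <= weight j.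
Proof. by rewrite divr_ge0 ?ler0n ?exprn_ge0. Qed.

(** Minimality of the certificate gives each program number at most one nonzero weight, so the sum,
    regrouped by program number, is dominated by the geometric series. *)
Lemma sum_weight_le2 n : \sum_(0 <= j < n) weight j <= 2.
Proof.
have le1 e : \sum_(0 <= j < n) ((first_halt j && (cfst j == e))%:R : R) <= 1.
  have [[k /andP[kn /andP[hk /eqP ke]]]|no] :=
      pselect (exists k, (k < n)%N && (first_halt k && (cfst k == e)));
        last first.
    rewrite big_nat big1 // => j /andP[_ jn]; case E: (_ && _) => //.
    by exfalso; apply: no; exists j; rewrite jn.
  rewrite (bigD1_seq k) ?mem_index_iota ?iota_uniq //= big1 => [|j jk].
    by rewrite addr0 hk ke eqxx.
  case E: (_ && _) => //; case/andP: E => hj /eqP je.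
  by move: jk; rewrite (first_halt_inj hj hk) ?eqxx // je.
have geo : \sum_(0 <= e < n) (2 ^- e : R) <= 2.
  suff -> : \sum_(0 <= e < n) (2 ^- e : R) = 2 - 2 * 2 ^- n.
    by rewrite gerBl mulr_ge0 // invr_ge0 exprn_ge0.
  elim: n {le1} => [|n IH]; first by rewrite big_geq // expr0 invr1 mulr1 subrr.
  by rewrite big_nat_recr //= IH exprS invfM; lra.
apply: le_trans geo.
have -> : \sum_(0 <= j < n) weight j =
    \sum_(0 <= e < n) (2 ^- e * \sum_(0 <= j < n) ((first_halt j && (cfst j ==
      e))%:R : R)).
  under [RHS]eq_bigr do rewrite mulr_sumr.
  rewrite exchange_big /=; apply: eq_big_nat => j /andP[_ jn].
  rewrite (bigD1_seq (cfst j)) ?mem_index_iota ?iota_uniq //=; last first.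
    exact: leq_ltn_trans (cfst_leq j) jn.
  rewrite big1 ?addr0 => [|e ej]; last by rewrite [cfst j ==
    e]eq_sym (negbTE ej) andbF mulr0.
  by rewrite eqxx andbT /weight mulrC.
apply: ler_sum => e _; rewrite -[leRHS]mulr1 ler_wpM2l // invr_ge0 exprn_ge0 //.
Qed.

Definition tterm j (y : X) : \bar R := (weight j * (y j)%:R)%:E.

Definition slow_test (y : X) : \bar R := (\sum_(j <oo) tterm j y)%E.

Lemma tterm_ge0 j y : (0 <= tterm j y)%E.
Proof. by rewrite lee_fin mulr_ge0 ?weight_ge0. Qed.

Lemma slow_test_ge0 y : (0 <= slow_test y)%E.
Proof. by apply: nneseries_ge0 => j _ _; exact: tterm_ge0. Qed.

Lemma nneseries_weight_le2 : (\sum_(j <oo) (weight j)%:E <= 2%:E)%E.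
Proof.
apply: lime_le; first by apply: is_cvg_nneseries => j _ _;
  rewrite lee_fin weight_ge0.
by apply: nearW => n; rewrite sumEFin lee_fin; exact: sum_weight_le2.
Qed.

Lemma slow_test_le2 y : (slow_test y <= 2%:E)%E.
Proof.
apply: le_trans nneseries_weight_le2.
apply: lee_nneseries => [j _ _|j _]; first exact: tterm_ge0.
by rewrite lee_fin ler_piMr ?weight_ge0 // lern1; case: (y j).
Qed.

Lemma measurable_tterm j : measurable_fun [set: borel X] (tterm j).
Proof.
apply: (@measurable_fun_prefix _ _ _ j.+1) => x y /eqP/pval_eqP/(_ j (ltnSn j)).
by rewrite /tterm => ->.
Qed.

Lemma measurable_slow_test : measurable_fun [set: borel X] slow_test.
Proof.
apply: (@ge0_emeasurable_sum _ _ _ _ (tterm : nat -> borel X -> _) xpredT).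
  by move=> j y _ _; exact: tterm_ge0.
by move=> j _; exact: measurable_tterm.
Qed.

(** For [j < n] the denominator of [weight j] divides 2^n, since [cfst j <= j]; the partial sum over
    a common denominator is thus computable from the name of the cylinder. *)
Lemma partial_sum_cyl n v (y : X) : cyl n v y ->
  \sum_(0 <= j < n) (weight j * (y j)%:R) =
  (\sum_(0 <= j < n) (bits v j && first_halt j) * 2 ^ (n - cfst j))%N%:R / 2 ^+
    n.
Proof.
move=> yv; have E : forall i, (i < n)%N -> y i = bits v i.
  by apply/pval_eqP; rewrite pval_bits yv.
rewrite natr_sum mulr_suml; apply: eq_big_nat => j /andP[_ jn].
rewrite E // natrM natrX /weight; case: (bits v j);
  last by rewrite mulr0 !mul0r.
case: (first_halt j); last by rewrite !mul0r.
have jn' : (cfst j <= n)%N by rewrite (leq_trans (cfst_leq j)) // ltnW.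
rewrite /= !mul1r mulr1 -[X in _ / 2 ^+ X](subnKC jn') exprD invfM mulrCA.
by rewrite divff ?mulr1 // expf_neq0 // pnatr_eq0.
Qed.

Lemma slow_test_gt (q : R) y : (q%:E < slow_test y)%E <->
  exists n, q < \sum_(0 <= j < n) (weight j * (y j)%:R).
Proof.
split=> [h|[n h]]; last first.
  apply: lt_le_trans (nneseries_lim_ge n (fun j _ _ => tterm_ge0 j y)).
  by rewrite sumEFin lte_fin.
have cv : (\sum_(0 <= j < n) tterm j y)%E @[n --> \oo] --> slow_test y.
  by apply: is_cvg_nneseries => j _ _; exact: tterm_ge0.
have [n _ /(_ n (leqnn n))] := cv _ (open_ereal_gt' h).
by rewrite /= sumEFin lte_fin; exists n.
Qed.

(** The terms are nonnegative, so exceeding [q] is witnessed by a partial sum, which is constant on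
    a cylinder. The superlevel set is the union of the cylinders on which the comparison, cleared of
    denominators in [P], succeeds. *)
Lemma slow_test_lsc : lsc slow_test.
Proof.
split=> [_ y|]; first by rewrite (lt_le_trans ltNy0) // slow_test_ge0.
pose P z := (cfst (csnd (cfst z)) * 2 ^ cfst (csnd z) <
  (\sum_(0 <= j < cfst (csnd z)) (bits (csnd (csnd z)) j && first_halt j) *
    2 ^ (cfst (csnd z) - cfst j)) * (csnd (csnd (csnd (cfst z)))).+1 +
  cfst (csnd (csnd (cfst z))) * 2 ^ cfst (csnd z))%N.
have hP : decidable_pred P.
  have h : computable (fun z => \sum_(0 <= j < cfst (csnd z))
      (bits (csnd (csnd z)) j && first_halt j) * 2 ^ (cfst (csnd z) - cfst
        j))%N.
    by apply: computable_bits_sum; comptac.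
  by rewrite /P; comptac.
have [||g cg gE] := @uniform_ceopen R P (fun z => cfst (csnd z))
  (fun z => csnd (csnd z)) hP; [comptac|comptac|].
have PE k q i (y : X) : @cyl R (cfst i) (csnd i) y -> P (cpair (cpair k q) i) =
    ((ratr (rat_num q) : R) < \sum_(0 <= j < cfst i) (weight j * (y j)%:R)).
  by move=> /partial_sum_cyl ->; rewrite rat_num_lt /P !cpairE.
exists g => // k q; rewrite gE; apply/seteqP; split => y /=.
  move=> /slow_test_gt[n h]; exists (cpair n (pval n y)).
    by rewrite /= (PE _ _ _ y) !cpairE //; exact: cyl_self.
  by rewrite !cpairE; exact: cyl_self.
move=> [i /=]; rewrite !cpairE => + yi; rewrite (PE _ _ _ y) // => h.
by apply/slow_test_gt; exists (cfst i).
Qed.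

Lemma slow_test_ml_test (p : R) : 1 < p -> ml_test nu p slow_test.
Proof.
move=> p1; have p0 : 0 <= p by rewrite (le_trans ler01) // ltW.
split; [exact: slow_test_lsc|exact: slow_test_ge0|].
rewrite unlock; apply: poweR_lty.
apply: (@le_lt_trans _ _ (\int[nu]_x (cst (2 `^ p)%:E x))%E).
  apply: ge0_le_integral => //.
  - by move=> y _; exact: poweR_ge0.
  - apply: (measurableT_comp (measurable_poweR p)).
    by apply: measurableT_comp => //; exact: measurable_slow_test.
  - move=> y _ /=; rewrite -poweR_EFin; apply: gt0_ler_poweR => //.
    + by rewrite in_itv /= abse_ge0 leey.
    + by rewrite in_itv /= lee_fin ler0n leey.
    + by rewrite gee0_abs ?slow_test_ge0 ?slow_test_le2.
rewrite integral_cst // [X in (_ * X)%E](_ : _ = 1%E) ?mule1 ?ltry //.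
exact: (probability_setT nu).
Qed.

(** Independence of bit [j] from the bits before it, for events [Q] on the latter. *)
Lemma coin_bit (Q : nat -> bool) j :
  coin [set y : X | Q (pval j y) && y j] =
  (2^-1%:E * coin [set y : X | Q (pval j y)])%E.
Proof.
have -> : [set y : X | Q (pval j y) && y j] =
    [set y | Q (pval j.+1 y %% 2 ^ j)%N && odd (pval j.+1 y %/ 2 ^ j)].
  have E (y : X) : (odd (pval j.+1 y %/ 2 ^ j) = y j)%N.
    rewrite /= addnC divnMDl ?expn_gt0 // divn_small ?pval_lt // addn0.
    by case: (y j).
  by apply/seteqP; split => y /=; rewrite -/(pval j.+1 y) pval_mod // E.
rewrite (coin_prefix (fun w => Q (w %% 2 ^ j)%N && odd (w %/ 2 ^ j)))
  coin_prefix.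
rewrite -EFinM exprS invfM mulrCA; congr (EFin (_ * (_%:R * _))).
have p0 : (0 < 2 ^ j)%N by rewrite expn_gt0.
rewrite expnS; move: (2 ^ j)%N p0 => p p0; rewrite mul2n -addnn.
(* Splitting at 2^j: the lower half has bit [j] equal to 0 and contributes nothing, the upper half
   is a shifted copy on which only [Q] remains. *)
rewrite (@big_cat_nat _ _ _ p) ?leq_addr //=
  [X in (X + _)%N]big_nat big1 ?add0n.
  rewrite -{1}[p]add0n big_addn addnK; apply: eq_big_nat => w /andP[_ wp].
  by rewrite modnDr modn_small // divnDr // divnn p0 divn_small //= andbT.
by move=> w /andP[_ wp]; rewrite divn_small // andbF.
Qed.

(** Conditioning on [n] bits fixes bit [j] when [j < n], and leaves it a fair coin otherwise. *)
Lemma integral_tterm n (x : X) j :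
  ((2 ^+ n)%:E * \int[nu]_(y in cyl n (pval n x)) tterm j y =
   (weight j * if (j < n)%N then (x j)%:R else 2^-1)%:E)%E.
Proof.
have mC := @measurable_cyl R n (pval n x).
pose b := [set y : borel X | y j].
have mb : measurable b.
  apply: borel_open; apply: (@open_prefix _ j.+1) => y z.
  by move=> /eqP/pval_eqP/(_ j (ltnSn j)); rewrite /b /= => ->.
have tE y : tterm j y = ((weight j)%:E * (\1_b y)%:E)%E.
  rewrite /tterm EFinM indicE; suff -> : (y \in b) = y j by [].
  by apply/idP/idP; rewrite inE.
under eq_integral do rewrite tE.
rewrite ge0_integralZl_EFin ?weight_ge0 //; last first.
  by apply/measurable_EFinP; apply: measurable_funTS; exact: measurable_indic.
rewrite integral_indic // muleCA [RHS]EFinM; congr (_ * _)%E.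
case: ltnP => jn.
  case xj : (x j).
    have -> : b `&` cyl n (pval n x) = cyl n (pval n x).
      apply/seteqP; split => y [] // => yc; split => //.
      move: yc; rewrite /cyl /= modn_small ?pval_lt // => /eqP/pval_eqP/(_ j
        jn).
      by rewrite xj /b /= => ->.
    exact: coin_cyl_scale.
  have -> : b `&` cyl n (pval n x) = set0.
    apply/seteqP; split => y // [yj]; rewrite /cyl /= modn_small ?pval_lt //.
    by move=> /eqP/pval_eqP/(_ j jn); rewrite xj => E; rewrite /b /= E in yj.
  by rewrite measure0 mule0.
(* Membership in the cylinder, read off the first [j >= n] bits as [coin_bit] requires. *)
pose Q w := (w %% 2 ^ n == pval n x %% 2 ^ n)%N.
have QE : cyl n (pval n x) = [set y : X | Q (pval j y)].
  by apply/seteqP; split => y; rewrite /Q => /(cyl_mod _ y jn).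
have -> : b `&` cyl n (pval n x) = [set y : X | Q (pval j y) && y j].
  rewrite QE; apply/seteqP; split => y /=; first by move=> [? ->]; apply/andP.
  by move=> /andP[].
transitivity ((2 ^+ n)%:E * (2^-1%:E * coin (@cyl R n (pval n x))))%E.
  by congr (_ * _)%E; rewrite QE; exact: coin_bit.
by rewrite muleCA coin_cyl_scale mule1.
Qed.

Definition tail n : \bar R := (\sum_(n <= j <oo) (weight j)%:E)%E.

Lemma tail_recl n : tail n = ((weight n)%:E + tail n.+1)%E.
Proof.
rewrite /tail (@nneseries_split _ _ n 1) ?addn1 ?big_nat1 //.
by move=> j _; rewrite lee_fin weight_ge0.
Qed.

Lemma tail_fin n : tail n \is a fin_num.
Proof.
rewrite ge0_fin_numE; last by apply: nneseries_ge0 => j _ _;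
  rewrite lee_fin weight_ge0.
apply: (@le_lt_trans _ _ 2%:E); last exact: ltry.
apply: le_trans nneseries_weight_le2.
rewrite (@nneseries_split _ (fun j => (weight j)%:E) 0 n).
  by rewrite leeDr // sume_ge0 // => j _; rewrite lee_fin weight_ge0.
by move=> j _; rewrite lee_fin weight_ge0.
Qed.

Lemma cond_exp_slow_test n (x : borel X) :
  (\int[crho n x]_y slow_test y =
   (\sum_(0 <= j < n) (weight j * (x j)%:R))%:E + 2^-1%:E * tail n)%E.
Proof.
rewrite integral_crho_ge0; [|exact: measurable_slow_test|exact: slow_test_ge0].
have mC := @measurable_cyl R n (pval n x).
rewrite /slow_test integral_nneseries //; last 2 first.
- by move=> j; apply: measurable_funTS; exact: measurable_tterm.
- by move=> j y _; exact: tterm_ge0.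
rewrite -nneseriesZl; last by move=> j _; apply: integral_ge0 => y _;
  exact: tterm_ge0.
under eq_eseriesr do rewrite integral_tterm.
rewrite (@nneseries_split _ _ 0 n); last first.
  by move=> j _; rewrite lee_fin mulr_ge0 ?weight_ge0 //; case: ifP.
rewrite add0n; congr (_ + _)%E.
  by rewrite sumEFin; congr EFin; apply: eq_big_nat => j /andP[_ ->].
rewrite -nneseriesZl; last by move=> j _; rewrite lee_fin weight_ge0.
rewrite [LHS]eseries_cond [RHS]eseries_cond;
  apply: eq_eseriesr => j /andP[_ nj].
by rewrite ltnNge nj /= -EFinM mulrC.
Qed.

Lemma cond_exp_slow_test_cvg (x : borel X) :
  (fun n => \int[crho n x]_y slow_test y)%E @ \oo --> slow_test x.
Proof.
under eq_fun do rewrite cond_exp_slow_test.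
rewrite -[slow_test x]adde0 -(mule0 (2^-1%:E)); apply: cvgeD.
- by rewrite mule0 fin_num_adde_defl.
- under eq_fun do rewrite -sumEFin.
  by apply: is_cvg_nneseries => j _ _; exact: tterm_ge0.
- apply: cvgeZl => //; apply: nneseries_tail_cvg.
    by rewrite (le_lt_trans nneseries_weight_le2) ?ltry.
  by move=> j _; rewrite lee_fin weight_ge0.
Qed.

(* Consecutive conditional expectations differ by exactly [weight n / 2]. *)
Lemma rate_weight (x : borel X) (m : rat -> nat) (eps : rat) n :
  is_rate (fun n => \int[crho n x]_y slow_test y)%E (slow_test x) m ->
  0 < eps -> (m eps <= n)%N -> weight n < 4 * ratr eps.
Proof.
move=> hm e0 mn.
have := hm _ e0 n mn; have := hm _ e0 n.+1 (leqW mn).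
rewrite !cond_exp_slow_test (tail_recl n) big_nat_recr //=.
have fx : slow_test x \is a fin_num.
  rewrite ge0_fin_numE ?slow_test_ge0 // (le_lt_trans (slow_test_le2 x)) ?ltry
    //.
rewrite -(fineK fx) -(fineK (tail_fin n.+1)).
rewrite -?(EFinM, EFinD, EFinB, EFinN) ?lte_fin.
move: (fine _) (fine _) (\sum_(0 <= j < n) _) => l t s.
rewrite !ltr_norml => /andP[h1 h2] /andP[h3 h4].
(* The gap [weight n / 2], of either sign according to the bit, is less than the sum of two errors
   below [eps]; hence the factor 4. *)
by move: h1 h2 h3 h4; case: (x n) => /= *; lra.
Qed.

Lemma no_computable_rate (x : borel X) : ~ exists m : rat -> nat,
  computable_rate m /\
  is_rate (fun n => \int[crho n x]_y slow_test y)%E (slow_test x) m.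
Proof.
move=> [m [[g cg mg] hm]].
(* Codes the precision 2^-(e+2), chosen so that four times it is exactly 2^-e, the weight carried by
   program [e] if it halts. *)
pose idx e := cpair 0 (2 ^ e.+2).-1.
have cidx : computable (fun e => g (idx e)) by apply: computable_comp cg _;
  rewrite /idx; comptac.
apply: (@halting_undecidable (fun e => has (halts e) (iota 0 (g (idx e))))).
  by comptac.
move=> e; split=> [/has_iotaP[w _ h]|[w h]]; first by exists w.
have [w' hw' _] := first_halt_exists h; apply/has_iotaP.
exists w'; last by case/andP: hw'; rewrite !cpairE.
rewrite ltnNge; apply/negP => mw.
have idxE : posrat_num (idx e) = 1 / 2 ^+ e.+2.
  by rewrite /posrat_num /idx !cpairE prednK ?expn_gt0 // natrX.
have /(@rate_weight _ _ (posrat_num (idx e)) (cpair e w') hm) :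
    0 < posrat_num (idx e) by rewrite idxE divr_gt0 ?exprn_gt0.
(* If the least certificate reached the rate, so would its position [cpair e w'], whose weight would
   then be strictly below 2^-e. *)
have le : (w' <= cpair e w')%N by rewrite (leq_trans _ (cpair_ge _ _)) //
  leq_addl.
move=> /(_ _); rewrite mg => /(_ (leq_trans mw le)).
rewrite /weight hw' cpairE idxE fmorph_div rmorphXn /= !ratr_nat rmorph1.
rewrite 2!exprS !invfM; lra.
Qed.

End slow_test.

Theorem theorem1p9 (R : realType) :
  exists (X : computablePolishType R) (nu : probability (borel X) R)
         (F : nat -> set (set X)) (rho : nat -> R.-ker borel X ~> borel X),
    [/\ computable_measure nu,
        almost_full_effective_filtration nu F,
        uniform_kurtz_disintegrations nu F rho
      & forall p : R, computable_real p -> 1 < p ->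
        forall x : X, DR nu rho x ->
        exists f : X -> \bar R,
          [/\ ml_test nu p f,
              (fun n => \int[rho n x]_y f y)%E @ \oo --> f x
            & ~ exists m : rat -> nat,
                computable_rate m /\
                is_rate (fun n => \int[rho n x]_y f y)%E (f x) m]].
Proof.
exists (cantorX R), (@coin R), (@cfilt R), (fun n => @crho R n).
split.
- exact: coin_computable.
- exact: cfilt_filtration.
- split.
  + move=> n x A mA; rewrite /= crhoE fin_numM // fin_num_measure //.
    by apply: measurableI => //; exact: measurable_cyl.
  + by move=> n f; exact: crho_cond_exp.
  + by move=> n x _; exact: crho_KR.
  + exact: crho_lsc.
move=> p _ p1 x _; exists slow_test; split.
- exact: slow_test_ml_test.
- exact: cond_exp_slow_test_cvg.
- exact: no_computable_rate.
Qed.
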